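(* Let $t\ge2$, $r\ge1$, $N=t+2r$, $\zeta=e^{2\pi i/t}$, and let $\lambda$ be a partition with at most $N$ parts. Suppose $s_\lambda(1,\zeta,\dots,\zeta^{t-1},z_1,z_1^{-1},\dots,z_r,z_r^{-1})\equiv0$ identically in $z_1,\dots,z_r$, and $n_i\ge1$ for every residue $i$ modulo $t$. Then $t$ is even, $|G|=2$, $\min\mathcal{S}+\max\mathcal{S}=\tau$, and $\mathcal{S}\setminus g_{\mathrm{com}}$ is symmetric about $\tau/2$, i.e. stable under $x\mapsto\tau-x$.
   Context: For $\lambda=(\lambda_1\ge\dots\ge\lambda_N\ge0)$ let $\beta_j=\lambda_j+N-j$ ($1\le j\le N$) and let $n_i$ be the number of $\beta_j\equiv i\pmod t$. Let $\mathcal{E}=\{i\in\mathbb{Z}/t:n_i\ge2\}$ and $\mathcal{S}=\{\beta_j:\beta_j\bmod t\in\mathcal{E}\}$; with $e=|\mathcal{E}|$ and all $n_i\ge1$ one has $|\mathcal{S}|=2r+e$. A choice $g$ is a subset of $\mathcal{S}$ containing exactly one value in each class $i\in\mathcal{E}$; put $T_g=\mathcal{S}\setminus g$, a set of $2r$ integers. For $T=\{u_1>\dots>u_{2r}\}$ put $\deg(T)=\sum_{a\le r}u_a-\sum_{a>r}u_a$; $G$ is the set of choices $g$ maximizing $\deg(T_g)$. When $|G|=2$, $g_{\mathrm{com}}$ is the intersection of the two elements of $G$. For $i\in\mathcal{E}$ list the values of $\mathcal{S}$ in class $i$ as $c_{i,1}>\dots>c_{i,n_i}$ and let $\Delta_i(k)=c_{i,k}+c_{i,k+1}$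 for $1\le k\le n_i-1$; there are $2r$ of these numbers in all, and $\tau$ is the $r$-th largest of them counted with multiplicity. *)

(* Defs.v *)
From HB Require Import structures.
From mathcomp Require Import all_boot all_order all_fingroup all_algebra.
From mathcomp Require Import finmap complex mpoly.
From mathcomp Require reals trigo.
Import reals trigo.

Set Implicit Arguments.
Unset Strict Implicit.
Unset Printing Implicit Defensive.

Import Order.TTheory GRing.Theory Num.Theory.

Local Open Scope ring_scope.

(* Indices are 0-based: beta lam j is lam_(j+1) + N - (j+1). *)
Definition beta (N : nat) (lam : 'I_N -> nat) (j : 'I_N) : nat :=
  (lam j + (N - j.+1))%N.

Definition alternant (K : idomainType) (N : nat) (a : 'I_N -> nat) :
    {mpoly K[N]} :=
  \det (\matrix_(i < N, j < N) 'X_i ^+ a j).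

(* The Schur polynomial is defined by the bialternant formula
     s_lam = det (X_i ^ (lam_j + N - j)) / det (X_i ^ (N - j));
   the next lemmas show that this quotient is a polynomial. *)
Section Quotient.
Variables (K : idomainType) (N : nat).
Implicit Types (p q : {mpoly K[N]}) (a : 'I_N -> nat) (i j k l : 'I_N).

Definition identify_tuple i j : N.-tuple {mpoly K[N]} :=
  [tuple 'X_(if k == i then j else k) | k < N].

Local Notation identify i j := (comp_mpoly (identify_tuple i j)).

Lemma identifyX i j k :
  identify i j 'X_k = 'X_(if k == i then j else k) :> {mpoly K[N]}.
Proof. by rewrite comp_mpolyXU -tnth_nth tnth_mktuple. Qed.

Lemma identify_sub_dvd i j p :
  exists q, p - identify i j p = ('X_i - 'X_j) * q.
Proof.
pose P p := exists q, p - identify i j p = ('X_i - 'X_j) * q.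
have PD p1 p2 : P p1 -> P p2 -> P (p1 + p2).
  case=> q1 e1 [q2 e2]; exists (q1 + q2).
  by rewrite rmorphD mulrDr -e1 -e2 opprD addrACA.
have PM p1 p2 : P p1 -> P p2 -> P (p1 * p2).
  case=> q1 e1 [q2 e2]; exists (q1 * p2 + identify i j p1 * q2).
  rewrite rmorphM mulrDr mulrA -e1 mulrCA -e2 mulrBl mulrBr addrA subrK.
  by [].
have PC c : P c%:MP by exists 0; rewrite comp_mpolyC subrr mulr0.
have PX k : P 'X_k.
  rewrite /P identifyX; case: (altP (k =P i)) => [->|_].
    by exists 1; rewrite mulr1.
  by exists 0; rewrite subrr mulr0.
rewrite -/(P p) [p]mpolyE; apply: (big_ind P) => [||m _]; first exact: (PC 0).
- exact: PD.
rewrite -mul_mpolyC; apply: (PM); first exact: PC.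
rewrite mpolyXE_id; apply: (big_ind P) => [||k _]; first exact: (PC 1).
- exact: (PM).
elim: (m k) => [|d IHd]; first exact: (PC 1).
by rewrite exprS; apply: (PM).
Qed.

Lemma identify_alternant i j a : i != j -> identify i j (alternant K a) = 0.
Proof.
move=> nij; rewrite /alternant -det_map_mx.
apply: (determinant_alternate nij) => k.
by rewrite !mxE !rmorphXn /= !identifyX eqxx [j == i]eq_sym (negPf nij).
Qed.

Lemma mvar_sub_eq0 i j : ('X_i - 'X_j == 0 :> {mpoly K[N]}) = (i == j).
Proof.
apply/idP/eqP => [|->]; last by rewrite subrr.
rewrite subr_eq0 => /eqP /(congr1 (fun p => p@_(U_(i)%MM))).
rewrite !mcoeffX eqxx; case: (altP (U_(j)%MM =P U_(i)%MM)) => [e _|_ /eqP].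
  move/mnmP: e => /(_ i); rewrite !mnm1E eqxx.
  by case: (altP (j =P i)).
by rewrite oner_eq0.
Qed.

Lemma prod_sub_dvd a (s : seq ('I_N * 'I_N)) :
  uniq s -> all (fun u : 'I_N * 'I_N => u.1 < u.2)%N s ->
  exists q, alternant K a = (\prod_(u <- s) ('X_(u.2) - 'X_(u.1))) * q.
Proof.
elim: s => [|[i j] s IHs] /=; first by exists (alternant K a); rewrite big_nil mul1r.
case/andP=> nin us /andP[/= lij lts]; have [q eq_q] := IHs us lts.
have nji : j != i by rewrite eq_sym neq_ltn lij.
have := identify_alternant a nji; rewrite eq_q rmorphM => /eqP.
rewrite mulf_eq0 => /orP[|/eqP q0].
  rewrite rmorph_prod prodf_seq_eq0 => /hasP[[k l] kl_s /=].
  rewrite rmorphB /= !identifyX mvar_sub_eq0.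
  have /= lkl := allP lts _ kl_s.
  case: (altP (l =P j)) => [lj|nlj]; case: (altP (k =P j)) => [kj|nkj] /eqP e.
  - by rewrite lj kj ltnn in lkl.
  - by case/negP: nin; rewrite e -lj.
  - by move: lkl; rewrite e kj ltnNge ltnW.
  - by rewrite e ltnn in lkl.
have [q' e'] := identify_sub_dvd j i q.
by exists q'; rewrite big_cons -mulrA mulrCA -e' q0 subr0.
Qed.

Lemma alternant_delta :
  exists b : bool, alternant K (beta (fun _ : 'I_N => 0%N)) =
    (-1) ^+ b * \prod_(i < N) \prod_(j < N | (i < j)%N) ('X_j - 'X_i).
Proof.
pose V := Vandermonde N (\row_j ('X_j : {mpoly K[N]})).
pose s : 'S_N := perm (can_inj (@rev_ordK N)).
exists (odd_perm s).
have -> : \prod_(i < N) \prod_(j < N | (i < j)%N) ('X_j - 'X_i) = \det V.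
  rewrite det_Vandermonde; apply: eq_bigr => i _; apply: eq_bigr => j _.
  by rewrite !mxE.
rewrite -det_perm -det_mulmx -row_permE /alternant -det_tr; congr (\det _).
by apply/matrixP => i j; rewrite !mxE permE.
Qed.

Lemma schur_exists (lam : 'I_N -> nat) :
  exists s : {mpoly K[N]},
    s * alternant K (beta (fun _ : 'I_N => 0%N)) == alternant K (beta lam).
Proof.
pose l := [seq u : 'I_N * 'I_N <- index_enum _ | (u.1 < u.2)%N].
have [||q eq_q] := @prod_sub_dvd (beta lam) l.
- exact/filter_uniq/index_enum_uniq.
- exact: filter_all.
have [b eq_b] := alternant_delta.
exists ((-1) ^+ b * q); rewrite eq_b eq_q mulrACA -signr_addb addbb mul1r.
by rewrite mulrC big_filter pair_big_dep.
Qed.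

Lemma alternant_delta_neq0 : alternant K (beta (fun _ : 'I_N => 0%N)) != 0.
Proof.
have [b ->] := alternant_delta; rewrite mulf_neq0 ?signr_eq0 //.
rewrite prodf_seq_neq0; apply/allP => i _ /=; rewrite prodf_seq_neq0.
apply/allP => j _; apply/implyP => lij.
by rewrite mvar_sub_eq0 neq_ltn lij orbT.
Qed.

End Quotient.

Definition schur (K : idomainType) (N : nat) (lam : 'I_N -> nat) :
    {mpoly K[N]} :=
  xchoose (schur_exists K lam).

Lemma schurP (K : idomainType) (N : nat) (lam : 'I_N -> nat) :
  schur K lam * alternant K (beta (fun _ : 'I_N => 0%N)) =
  alternant K (beta lam).
Proof. exact/eqP/(xchooseP (schur_exists K lam)). Qed.

Lemma schur_unique (K : idomainType) (N : nat) (lam : 'I_N -> nat)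
    (s : {mpoly K[N]}) :
  s * alternant K (beta (fun _ : 'I_N => 0%N)) = alternant K (beta lam) ->
  s = schur K lam.
Proof.
rewrite -(schurP K lam) => e; exact: (mulIf (alternant_delta_neq0 K N) e).
Qed.

(* exp(2 pi i / t) *)
Definition zeta (R : realType) (t : nat) : R[i] :=
  (cos (2 * pi / t%:R) +i* sin (2 * pi / t%:R))%C.

(* The point (1, zeta, ..., zeta^(t-1), z_1, z_1^-1, ..., z_r, z_r^-1). *)
Definition spec_point (R : realType) (t r : nat) (z : 'I_r -> R[i])
    (k : 'I_(t + 2 * r)) : R[i] :=
  nth 0 ([seq zeta R t ^+ m | m <- iota 0 t] ++
         flatten [seq [:: z a; (z a)^-1] | a <- enum 'I_r]) k.
Arguments spec_point {R} t {r} z k.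

Local Open Scope fset_scope.

Definition dec_seq (A : {fset nat}) : seq nat := sort geq A.

Definition fset_max (A : {fset nat}) : nat := head 0%N (dec_seq A).
Definition fset_min (A : {fset nat}) : nat := last 0%N (dec_seq A).

Definition res_class (t : nat) (A : {fset nat}) (i : nat) : {fset nat} :=
  [fset x in A | x %% t == i]%N.

Section Combinatorics.
Variables (t r : nat) (lam : 'I_(t + 2 * r) -> nat).

(* Residue classes modulo t are represented by the naturals i < t. *)
Definition n_ (i : nat) : nat :=
  #|[set j : 'I_(t + 2 * r) | beta lam j %% t == i]%N|.

Definition calE : {fset nat} := [fset i in iota 0 t | 2 <= n_ i]%N.

Definition calS : {fset nat} :=
  [fset x in [seq beta lam j | j : 'I_(t + 2 * r)] | (x %% t)%N \in calE].

Definition is_choice (g : {fset nat}) : bool :=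
  (g `<=` calS) && all (fun i => #|` res_class t g i| == 1%N) calE.

Definition deg (T : {fset nat}) : int :=
  \sum_(0 <= a < r) (nth 0%N (dec_seq T) a)%:Z
  - \sum_(r <= a < 2 * r) (nth 0%N (dec_seq T) a)%:Z.

Definition calG : {fset {fset nat}} :=
  [fset g in fpowerset calS | is_choice g &&
    all (fun h => is_choice h ==> (deg (calS `\` h) <= deg (calS `\` g)))
        (fpowerset calS)].

(* When calG has two elements, this is their intersection. *)
Definition g_com : {fset nat} :=
  [fset x in calS | all (fun g : {fset nat} => x \in g) calG].

Definition Delta (i : nat) : seq nat :=
  let c := dec_seq (res_class t calS i) in
  [seq (nth 0 c k + nth 0 c k.+1)%N | k <- iota 0 (size c).-1].

Definition tau : nat :=
  nth 0%N (sort geq (flatten [seq Delta i | i <- calE])) r.-1.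

End Combinatorics.

(* Main.v *)
Require Import Defs.
From HB Require Import structures.
From mathcomp Require Import all_boot all_order all_fingroup all_algebra.
From mathcomp Require Import finmap complex mpoly.
From mathcomp Require Import ring lra zify.
From mathcomp Require reals trigo.
Import reals trigo.
Set Implicit Arguments.
Unset Strict Implicit.
Unset Printing Implicit Defensive.
Import Order.TTheory GRing.Theory Num.Theory.
Local Open Scope ring_scope.

(* Write c' = 2c - tau, and let P (resp. Q) be the betas c having a smaller
   (resp. larger) congruent beta d with c + d > tau (resp. < tau). Vanishing of
   the specialized alternant means that for all z the matrix with rows
   (zeta^(k beta)), (z_a^beta), (z_a^-beta) has a kernel vector. A discrete Fourier
   transform of the first t rows turns them into the indicators of the residue
   classes. Scaling z to infinity while rescaling the columns by u^|c'| leaves, at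
   the limit, a kernel vector x such that
     x sums to 0 over the elements of least |c'| in each class,
     sum_(c' >= 0) x_c z_a^c = 0 and sum_(c' <= 0) x_c z_a^-c = 0.
   A class has either one element of least |c'|, or two: a "tie" {a, tau - a}. In
   the latter case 2a = tau mod t, so there are at most two ties, and t is even if
   there are two. By definition of tau, #P < r <= #P + #ties and
   #P + #ties + #Q = 2r; if #P + #ties = r then generalized Vandermonde determinants
   force x = 0. Hence there are two ties {a, tau - a}, {b, tau - b}, and
   #P = #Q = r - 1. By Cramer's rule, with D_U = det (z_i^u) over u in U and
   Q' = tau - Q,
     (D_(P+a) D_(Q'+b))^2 = (D_(P+b) D_(Q'+a))^2,
   which implies P = Q': letting one variable tend to 0 strips the smallest
   exponents, and the last step is the product formula at z_i = 2^i.
   Finally 2 deg T <= sum_(c in T) |c'|, with equality iff T is balanced around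
   tau/2, identifies the two maximizing choices. *)

(** * Generalized Vandermonde determinants *)

Section Alternants.
Variable F : numFieldType.
Implicit Types (z : nat -> F) (s : seq int) (p q : {poly F}).

Definition alt (n : nat) z s : F := \det (\matrix_(i < n, j < n) z i ^ s`_j).

(** In characteristic zero, $1,\dots,$ [size (p - q)] would be distinct nonzero roots of [p - q],
    one more than its degree allows. *)
Lemma poly_eq_punctured p q :
  (forall u, u != 0 -> p.[u] = q.[u]) -> p = q.
Proof.
move=> H; apply/eqP; rewrite -subr_eq0; apply/negPn/negP => nz.
pose rs := [seq i.+1%:R : F | i <- iota 0 (size (p - q))].
have := @max_poly_roots _ _ rs nz.
rewrite size_map size_iota ltnn => H'; suff: false by []; apply: H'.
  apply/allP => _ /mapP[i _ ->]; rewrite /root hornerD hornerN H ?subrr //.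
  by rewrite pnatr_eq0.
rewrite map_inj_uniq ?iota_uniq // => i j /eqP.
by rewrite eqr_nat => /eqP[].
Qed.

(** The algebraic form of letting a variable tend to 0: equal orders at 0 give equal leading
    coefficients, and nonzero constant terms make [e] and [f] the orders of the two sides. *)
Lemma expz_poly_at0 (e f : int) p q :
  (forall w, w != 0 -> w ^ e * p.[w] = w ^ f * q.[w]) ->
  (e = f -> p.[0] = q.[0]) /\ (p.[0] != 0 -> q.[0] != 0 -> e = f).
Proof.
move=> H; split=> [ef|].
  suff -> : p = q by [].
  apply: poly_eq_punctured => u u0; have := H u u0; rewrite ef.
  by apply: mulfI; rewrite expfz_neq0.
wlog lt_ef : e f p q H / e < f => [hw p0 q0|].
  have [lt|lt|//] := ltgtP e f; first exact: (hw _ _ p q).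
  by apply/esym/(hw _ _ q p) => // w w0; rewrite H.
move=> p0 q0; pose k := `|f - e|%N.
have fE : f = e + k%:Z by rewrite /k; lia.
suff pE : p = 'X^k * q.
  have k0 : (k == 0%N) = false by apply/eqP; rewrite /k; lia.
  by move: p0; rewrite pE hornerM hornerXn expr0n k0 mul0r eqxx.
apply: poly_eq_punctured => u u0; apply: (@mulfI _ (u ^ e)).
  by rewrite expfz_neq0.
by rewrite H // fE expfzDr // hornerM hornerXn mulrA.
Qed.

Definition zcons (w : F) z (i : nat) : F := if i is i'.+1 then z i' else w.

Lemma zcons_neq0 w z : w != 0 -> (forall i, z i != 0) ->
  forall i, zcons w z i != 0.
Proof. by move=> w0 z0 []. Qed.

(** Since [m] is the least exponent, [w ^ m] factors out of the first row. The remaining first row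
    is $(1,0,\dots,0)$ at $w=0$, which strips off both the new variable and the exponent [m]. *)
Lemma alt_zcons n z (m : int) s : (forall i, z i != 0) -> size s = n ->
  all (fun x => m < x) s ->
  exists p, p.[0] = alt n z s /\
    forall w, w != 0 -> alt n.+1 (zcons w z) (m :: s) = w ^ m * p.[w].
Proof.
move=> z0 sz ms.
pose M : 'M[{poly F}]_n.+1 := \matrix_(i, j)
  if val i == 0%N then 'X^(absz ((m :: s)`_j - m)%R) else ((zcons 0 z i) ^ (m :: s)`_j)%:P.
have lem (j : 'I_n.+1) : m <= (m :: s)`_j.
  case: j => -[|j] //= lj; apply/ltW/(allP ms); rewrite mem_nth // sz.
  by rewrite ltnS in lj.
exists (\det M); split.
  rewrite -horner_evalE -det_map_mx (expand_det_row _ ord0) (bigD1 ord0) //= big1 ?addr0.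
    rewrite !mxE /= horner_evalE subrr expr0 hornerC mul1r.
    rewrite /cofactor expr0 mul1r /alt; congr (\det _).
    by apply/matrixP => i j; rewrite !mxE /= horner_evalE hornerC.
  move=> j nj; rewrite !mxE /= horner_evalE hornerXn expr0n.
  suff -> : (absz ((m :: s)`_j - m)%R == 0%N) = false by rewrite mul0r.
  case: j nj => -[|j] //= lj _; have := allP ms s`_j.
  rewrite mem_nth ?sz //.
  by move=> /(_ isT) lt_m; apply/negbTE; rewrite absz_eq0 subr_eq0 gt_eqF.
move=> w w0; rewrite -horner_evalE -det_map_mx.
pose D : 'rV[F]_n.+1 := \row_i (if val i == 0%N then w ^ m else 1).
have -> : w ^ m = \det (diag_mx D).
  rewrite det_diag big_ord_recl /= mxE /= big1 ?mulr1 // => i _.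
  by rewrite mxE.
rewrite -det_mulmx; congr (\det _); apply/matrixP => i j.
rewrite mul_diag_mx !mxE /=; case: i => -[|i] li /=; last first.
  by rewrite horner_evalE hornerC mul1r.
rewrite horner_evalE hornerXn exprnP abszE ger0_norm ?subr_ge0 //.
by rewrite -expfzDr // addrC subrK.
Qed.

Lemma det_sqr_col_perm n (A : 'M[F]_n) (g : 'S_n) :
  (\det (col_perm g A)) ^+ 2 = (\det A) ^+ 2.
Proof. by rewrite col_permE det_mulmx det_perm exprMn sqrr_sign mulr1. Qed.

Lemma alt_sqr_perm n z s1 s2 : size s1 = n -> perm_eq s1 s2 ->
  (alt n z s1) ^+ 2 = (alt n z s2) ^+ 2.
Proof.
move=> sz s12; have sz2 : size s2 = n by rewrite -(perm_size s12).
have := s12; rewrite -[s1]/(tval (Tuple (introT eqP sz))).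
rewrite -[X in perm_eq _ X]/(tval (Tuple (introT eqP sz2))).
case/tuple_permP => g /= s1E.
rewrite -[RHS](det_sqr_col_perm _ g); congr (\det _ ^+ 2).
apply/matrixP => i j; rewrite !mxE; congr (_ ^ _).
by rewrite s1E (nth_map j) ?size_enum_ord // nth_ord_enum (tnth_nth 0).
Qed.

(** The test point of all nonvanishing arguments: as $(2^i)^y=(2^y)^i$, the alternant becomes an
    ordinary Vandermonde determinant with nodes $2^y$, nonzero for distinct exponents. *)
Definition pow2 (i : nat) : F := 2 ^+ i.

Lemma pow2_neq0 i : pow2 i != 0.
Proof. by rewrite expf_neq0 // pnatr_eq0. Qed.

(** Powers of 2 are compared through the rationals, because [F] is only partially ordered. *)
Lemma two_expzE (m : int) : (2 : F) ^ m = ratr (2%:R ^ m).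
Proof. by rewrite fmorphXz rmorph_nat. Qed.

Lemma two_expz_inj : injective (fun m : int => (2 : F) ^ m).
Proof.
by move=> m n /eqP; rewrite !two_expzE fmorph_eq => /eqP; apply: ieexprIz.
Qed.

Lemma alt_pow2_cons n (m : int) s : size s = n ->
  alt n.+1 pow2 (m :: s) = \prod_(y <- s) (2 ^ y - 2 ^ m) * alt n pow2 s.
Proof.
have vE k r : alt k pow2 r = \det (Vandermonde k (\row_(j < k) ((2 : F) ^ r`_j))).
  congr (\det _); apply/matrixP => i j; rewrite !mxE /pow2.
  by rewrite !exprnP !exprz_exp mulrC.
move=> sz; rewrite !vE !det_Vandermonde big_ord_recl; congr (_ * _).
  rewrite [RHS](big_nth 0) sz big_mkord big_mkcond big_ord_recl /= mul1r.
  by apply: eq_bigr => i _; rewrite !mxE.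
apply: eq_bigr => i _; rewrite big_mkcond big_ord_recl /= mul1r -big_mkcond /=.
by apply: eq_big => [j|j _]; rewrite ?mxE.
Qed.

Lemma alt_pow2_neq0 n s : size s = n -> uniq s -> alt n pow2 s != 0.
Proof.
elim: s n => [|m s IH] [|n] //=; first by rewrite /alt det_mx00 oner_neq0.
case=> sz /andP[ms us]; rewrite alt_pow2_cons // mulf_neq0 ?IH //.
rewrite prodf_seq_neq0; apply/allP => y ys /=.
rewrite subr_eq0; apply: contraNneq ms => /two_expz_inj <- //.
Qed.

(* Squares make the relation insensitive to the order of the exponents. *)
Definition altrel n (s1 s2 s3 s4 : seq int) := forall z, (forall i, z i != 0) ->
  (alt n z s1 * alt n z s2) ^+ 2 = (alt n z s3 * alt n z s4) ^+ 2.

Lemma altrel_perm n s1 s2 s3 s4 s1' s2' s3' s4' :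
  size s1 = n -> size s2 = n -> size s3 = n -> size s4 = n ->
  perm_eq s1 s1' -> perm_eq s2 s2' -> perm_eq s3 s3' -> perm_eq s4 s4' ->
  altrel n s1 s2 s3 s4 -> altrel n s1' s2' s3' s4'.
Proof.
move=> z1 z2 z3 z4 p1 p2 p3 p4 H z z0; have := H z z0; rewrite !exprMn.
by rewrite (alt_sqr_perm z z1 p1) (alt_sqr_perm z z2 p2)
  (alt_sqr_perm z z3 p3) (alt_sqr_perm z z4 p4).
Qed.

(** Let the first variable [w] tend to 0: the orders in [w] give the equation between minima, the
    leading coefficients the relation between the remaining exponents. *)
Lemma altrel_peel n (m1 m2 m3 m4 : int) s1 s2 s3 s4 :
  size s1 = n -> size s2 = n -> size s3 = n -> size s4 = n ->
  uniq s1 -> uniq s2 -> uniq s3 -> uniq s4 ->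
  all (fun x => m1 < x) s1 -> all (fun x => m2 < x) s2 ->
  all (fun x => m3 < x) s3 -> all (fun x => m4 < x) s4 ->
  altrel n.+1 (m1 :: s1) (m2 :: s2) (m3 :: s3) (m4 :: s4) ->
  m1 + m2 = m3 + m4 /\ altrel n s1 s2 s3 s4.
Proof.
move=> z1 z2 z3 z4 u1 u2 u3 u4 l1 l2 l3 l4 H.
have key z : (forall i, z i != 0) -> exists p q : {poly F},
    [/\ p.[0] = (alt n z s1 * alt n z s2) ^+ 2,
        q.[0] = (alt n z s3 * alt n z s4) ^+ 2 &
        forall w, w != 0 -> w ^ ((m1 + m2) * 2%:Z) * p.[w] = w ^ ((m3 + m4) * 2%:Z) * q.[w]].
  move=> z0; have [p1 [e1 h1]] := alt_zcons z0 z1 l1.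
  have [p2 [e2 h2]] := alt_zcons z0 z2 l2.
  have [p3 [e3 h3]] := alt_zcons z0 z3 l3.
  have [p4 [e4 h4]] := alt_zcons z0 z4 l4.
  exists ((p1 * p2) ^+ 2), ((p3 * p4) ^+ 2); split.
  - by rewrite horner_exp hornerM e1 e2.
  - by rewrite horner_exp hornerM e3 e4.
  move=> w w0; have := H _ (zcons_neq0 w0 z0).
  rewrite h1 // h2 // h3 // h4 // => E.
  have aux (m m' : int) (x y : F) : w ^ ((m + m') * 2%:Z) * (x * y) ^+ 2 =
      (w ^ m * x * (w ^ m' * y)) ^+ 2.
    by rewrite -exprz_exp expfzDr // -exprnP; ring.
  by rewrite !horner_exp !hornerM !aux.
(* At [pow2] both leading coefficients are nonzero, so the two orders must agree. *)
have e : m1 + m2 = m3 + m4.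
  have [p [q [ep eq' h]]] := key _ pow2_neq0.
  have [_] := expz_poly_at0 h; rewrite ep eq' !expf_eq0 /= !mulf_eq0 !negb_or.
  rewrite !alt_pow2_neq0 // => /(_ isT isT); lia.
split=> // z z0; have [p [q [<- <- h]]] := key _ z0.
by have [+ _] := expz_poly_at0 h; apply; rewrite e.
Qed.

End Alternants.

(** * Exchange relations between alternants determine the exponents *)

Section Uniqueness.
Variable F : numFieldType.
Implicit Types (z : nat -> F) (s P Q : seq int) (p q a b m : int).
Local Notation altrel := (@altrel F).

Lemma perm_min_cons s : uniq s -> s != [::] ->
  exists m s', perm_eq s (m :: s') /\ all (fun x => m < x) s'.
Proof.
move=> us s0; case E : (sort <=%R s) => [|m s'].
  by move: s0; rewrite -size_eq0 -(size_sort <=%R) E.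
exists m, s'; split; first by rewrite -E perm_sym perm_sort.
have : sorted <%R (sort <=%R s) by rewrite sort_lt_sorted.
by rewrite E /= => /order_path_min; apply; apply: lt_trans.
Qed.

(** As [p] and [q] are the minima of their own lists, only the smaller of the extra exponent and [p]
    (or [q]) is stripped; the larger one becomes the new extra exponent. *)
Lemma altrel_peel_min n a b p q P Q : size P = n -> size Q = n ->
  uniq [:: a, p & P] -> uniq [:: b, q & Q] ->
  uniq [:: b, p & P] -> uniq [:: a, q & Q] ->
  all (fun x => p < x) P -> all (fun x => q < x) Q ->
  altrel n.+2 [:: a, p & P] [:: b, q & Q] [:: b, p & P] [:: a, q & Q] ->
  Num.min a p + Num.min b q = Num.min b p + Num.min a q /\
  altrel n.+1 (Num.max a p :: P) (Num.max b q :: Q)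
              (Num.max b p :: P) (Num.max a q :: Q).
Proof.
move=> zP zQ u1 u2 u3 u4 lP lQ H.
have swap x y s : uniq [:: x, y & s] -> all (fun x => y < x) s ->
    [/\ perm_eq [:: x, y & s] [:: Num.min x y, Num.max x y & s],
        all (fun t => Num.min x y < t) (Num.max x y :: s) &
        uniq (Num.max x y :: s)].
  rewrite /= inE negb_or -andbA => /and4P[nxy nx ny us] ly.
  have ltall t : t < y -> all (fun x => t < x) s.
    by move=> lt; apply: sub_all ly => u; apply: lt_trans.
  have [lt|gt|/eqP] := ltgtP x y; last by rewrite (negPf nxy).
    by split; rewrite /= ?perm_refl ?lt ?ltall ?ny.
  split; rewrite /= ?gt ?ly ?nx //.
  exact: (permEl (perm_catCA [:: x] [:: y] s)).
have [e1 l1 v1] := swap _ _ _ u1 lP; have [e2 l2 v2] := swap _ _ _ u2 lQ.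
have [e3 l3 v3] := swap _ _ _ u3 lP; have [e4 l4 v4] := swap _ _ _ u4 lQ.
apply: altrel_peel v1 v2 v3 v4 l1 l2 l3 l4 _; rewrite /= ?zP ?zQ //.
by apply: altrel_perm e1 e2 e3 e4 H; rewrite /= ?zP ?zQ.
Qed.

(** At [pow2] all factors coming from [P] cancel. What remains is
    $(2^p-2^a)(2^q-2^b)=\pm(2^p-2^b)(2^q-2^a)$. The sign is $+$, and the difference of the two
    products is $(2^p-2^q)(2^a-2^b)$. *)
Lemma altrel_exchange n a b p q P Q : size P = n -> perm_eq P Q ->
  uniq (p :: P) -> uniq (q :: Q) -> a \notin P -> b \notin P ->
  a != b -> p < a -> p < b -> q < a -> q < b ->
  altrel n.+2 [:: a, p & P] [:: b, q & Q] [:: b, p & P] [:: a, q & Q] ->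
  p = q.
Proof.
move=> zP PQ uP uQ aP bP nab pa pb qa qb H.
have zQ : size Q = n by rewrite -(perm_size PQ).
have {H} := H _ (pow2_neq0 F).
have zp c : size (c :: P) = n.+1 by rewrite /= zP.
have zq c : size (c :: Q) = n.+1 by rewrite /= zQ.
rewrite !(alt_pow2_cons F _ (zp _)) !(alt_pow2_cons F _ (zq _)) !big_cons -!(perm_big _ PQ) /=.
set V1 := alt _ _ _; set V2 := alt _ _ _.
have V10 : V1 != 0 by apply: alt_pow2_neq0; rewrite //= zP.
have V20 : V2 != 0 by apply: alt_pow2_neq0; rewrite //= zQ.
have W0 c : c \notin P -> \prod_(y <- P) ((2 : F) ^ y - 2 ^ c) != 0.
  move=> cP; rewrite prodf_seq_neq0; apply/allP => y yP /=.
  by rewrite subr_eq0; apply: contraNneq cP => /two_expz_inj <-.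
have := W0 a aP; have := W0 b bP; set Wa := \prod_(y <- P) _; set Wb := \prod_(y <- P) _.
move=> Wa0 Wb0.
rewrite [LHS](_ : _ = (((2 ^ p - 2 ^ a) * (2 ^ q - 2 ^ b)) *
  (Wa * Wb * V1 * V2)) ^+ 2); last by ring.
rewrite [RHS](_ : _ = (((2 ^ p - 2 ^ b) * (2 ^ q - 2 ^ a)) *
  (Wa * Wb * V1 * V2)) ^+ 2); last by ring.
have two_lt x y : x < y -> (2 : F) ^ x - 2 ^ y < 0.
  by move=> xy; rewrite subr_lt0 (two_expzE F x) (two_expzE F y) ltr_rat ltr_eXz2l.
rewrite exprMn [RHS]exprMn => /mulIf E.
have {E} /eqP := E (expf_neq0 _ (mulf_neq0 (mulf_neq0 (mulf_neq0 Wa0 Wb0) V10) V20)).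
rewrite eqrXn2 ?ltW ?nmulr_rgt0 ?two_lt // => /eqP E.
have : (2 ^ p - 2 ^ q) * (2 ^ a - 2 ^ b) = 0 :> F.
  rewrite [LHS](_ : _ = (2 ^ p - 2 ^ a) * (2 ^ q - 2 ^ b) -
    (2 ^ p - 2 ^ b) * (2 ^ q - 2 ^ a)); last by ring.
  by rewrite E subrr.
move/eqP; rewrite mulf_eq0 !subr_eq0 => /orP[]/eqP/two_expz_inj // /eqP.
by rewrite (negPf nab).
Qed.

(** Induction on the number of exponents, stripping the minima. This makes progress when some
    element of [P] or [Q] lies below [a] or [b] ([core]); otherwise inverting the variables leads to
    that case. *)
Lemma altrel_unique n a b P Q : size P = n -> size Q = n ->
  uniq (a :: P) -> uniq (b :: Q) -> uniq (b :: P) -> uniq (a :: Q) -> a != b ->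
  altrel n.+1 (a :: P) (b :: Q) (b :: P) (a :: Q) -> perm_eq P Q.
Proof.
elim: n a b P Q => [|n IH] a b P Q; first by move=> /size0nil -> /size0nil ->.
have core P' Q' a' b' : size P' = n.+1 -> size Q' = n.+1 ->
    uniq (a' :: P') -> uniq (b' :: Q') -> uniq (b' :: P') -> uniq (a' :: Q') ->
    a' != b' -> 
    has (fun x => (x < a') || (x < b')) (P' ++ Q') ->
    altrel n.+2 (a' :: P') (b' :: Q') (b' :: P') (a' :: Q') -> perm_eq P' Q'.
  move=> zP zQ u1 u2 u3 u4 nab low H.
  have [||p [P0 [eP lP]]] := @perm_min_cons P'.
  - by case/andP: u1.
  - by rewrite -size_eq0 zP.
  have [||q [Q0 [eQ lQ]]] := @perm_min_cons Q'.
  - by case/andP: u2.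
  - by rewrite -size_eq0 zQ.
  have zP0 : size P0 = n by apply: eq_add_S; rewrite -zP (perm_size eP).
  have zQ0 : size Q0 = n by apply: eq_add_S; rewrite -zQ (perm_size eQ).
  have cE c s s' : perm_eq s s' -> perm_eq (c :: s) (c :: s') by rewrite perm_cons.
  have {}low : has (fun x => (x < a') || (x < b')) [:: p; q].
    case/hasP: low => x; rewrite mem_cat (perm_mem eP) (perm_mem eQ) !inE.
    move=> xin lx; have : (p <= x) || (q <= x).
      case/orP: xin => /orP[/eqP->|xi]; rewrite ?lexx ?orbT //.
        by rewrite (ltW (allP lP _ xi)).
      by rewrite (ltW (allP lQ _ xi)) orbT.
    rewrite /= orbF => /orP[] le; case/orP: lx => lx;
      by rewrite (le_lt_trans le lx) ?orbT.
  move: u1 u2 u3 u4.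
  rewrite (perm_uniq (cE a' _ _ eP)) (perm_uniq (cE b' _ _ eQ)).
  rewrite (perm_uniq (cE b' _ _ eP)) (perm_uniq (cE a' _ _ eQ)) => u1 u2 u3 u4.
  have {}H : altrel n.+2 [:: a', p & P0] [:: b', q & Q0] [:: b', p & P0] [:: a', q & Q0].
    by apply: altrel_perm H; rewrite ?perm_cons //= ?zP ?zQ.
  have [e H'] := altrel_peel_min zP0 zQ0 u1 u2 u3 u4 lP lQ H.
  rewrite (permPl eP) perm_sym (permPl eQ) perm_sym.
  move: u1 u2 u3 u4 => /=; rewrite !inE !negb_or -!andbA.
  move=> /and4P[ap aP pP uP] /and4P[bq bQ qQ uQ] /and3P[bp bP _] /and3P[aq aQ _].
  have uP0 c : c \notin P0 -> uniq (c :: P0) by move=> cP /=; rewrite cP.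
  have uQ0 c : c \notin Q0 -> uniq (c :: Q0) by move=> cQ /=; rewrite cQ.
  have nab' : a' <> b' by apply/eqP.
  move: low e H'; rewrite /= orbF.
  case: (ltgtP a' p) ap => // ap _; case: (ltgtP b' p) bp => // bp _;
  case: (ltgtP a' q) aq => // aq _; case: (ltgtP b' q) bq => // bq _ _ e H'.
  (* The equation between minima leaves three orders: [p = q] strictly between [a'] and [b']
     (twice), or [p] and [q] both below [a'] and [b']. *)
  all: try by exfalso; clear -e ap bp aq bq nab'; lia.
  - have pq : p = q by clear -e; lia.
    by subst q; rewrite perm_cons (IH p b') ?uP0 ?uQ0 ?lt_eqF.
  - have pq : p = q by clear -e; lia.
    by subst q; rewrite perm_cons (IH a' p) ?uP0 ?uQ0 ?gt_eqF.
  have PQ0 := IH _ _ _ _ zP0 zQ0 (uP0 _ aP) (uQ0 _ bQ) (uP0 _ bP) (uQ0 _ aQ) nab H'.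
  by rewrite (altrel_exchange zP0 PQ0 _ _ aP bP _ _ _ _ _ H) ?uP0 ?uQ0 // perm_cons.
move=> zP zQ u1 u2 u3 u4 nab H.
have [low|] := boolP (has (fun x => (x < a) || (x < b)) (P ++ Q)).
  exact: core H.
case: P zP u1 u3 H => // p P zP u1 u3 H /hasPn above.
(* Now everything lies above [a] and [b]. Replacing each [z i] by its inverse negates all exponents
   and reverses their order. *)
have -> : perm_eq (p :: P) Q = perm_eq (map -%R (p :: P)) (map -%R Q).
  by apply/idP/idP => [/perm_map->|/(perm_map_inj oppr_inj)].
have uN c s : uniq (c :: s) -> uniq (- c :: map -%R s).
  by rewrite -[- c :: _]/(map -%R (c :: s)) map_inj_uniq //; apply: oppr_inj.
apply: (core _ _ (- a) (- b)); rewrite ?size_map ?uN // ?eqr_opp //=.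
  move: (above p); rewrite inE eqxx negb_or -!leNgt => /(_ isT)/andP[ap _].
  move: u1; rewrite /= inE negb_or => /andP[/andP[npa _] _].
  by rewrite ltrN2 lt_neqAle npa ap.
have altN k s z : size s = k -> alt k (fun i => (z i)^-1) s = alt k z (map -%R s).
  move=> sz; congr (\det _); apply/matrixP => i j; rewrite !mxE.
  by rewrite (nth_map 0) ?sz // exprz_inv.
move=> z z0; have := H (fun i => (z i)^-1) (fun i => invr_neq0 (z0 i)).
by case: zP => zP; rewrite !altN /= ?zP ?zQ.
Qed.

End Uniqueness.

(** * Degeneration of the specialized alternant *)

Section Kernel.

(** For $0<k<t$ one has $\cos(2\pi k/t)=1-2\sin^2(\pi k/t)<1$, so no earlier power is 1. *)
Lemma zeta_prim_root (R : realType) t : (0 < t)%N -> t.-primitive_root (zeta R t).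
Proof.
move=> t0; pose th : R := 2 * pi / t%:R.
have zX n : zeta R t ^+ n = (cos (th *+ n) +i* sin (th *+ n))%C.
  elim: n => [|n IH]; first by rewrite expr0 mulr0n cos0 sin0.
  by rewrite exprS IH mulrS cosD sinD /zeta -/th; simpc; rewrite addrC [_ + sin _ * _]addrC.
have t0' : (0 : R) < t%:R by rewrite ltr0n.
have tn0 : (t%:R : R) != 0 by rewrite gt_eqF.
apply/andP; split=> //; apply/forallP => i; apply/eqP.
rewrite unity_rootE zX; have [->|nit] := eqVneq i.+1 t.
  rewrite -mulr_natr /th divfK // mulr_natl cos2pi sin2pi.
  by rewrite eqxx.
apply/negbTE; rewrite eq_complex negb_and /=; apply/orP; left.
have lit : (i.+1 < t)%N by rewrite ltn_neqAle nit ltn_ord.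
pose h : R := pi * i.+1%:R / t%:R.
have -> : th *+ i.+1 = h *+ 2 by rewrite /th /h -mulr_natr -[RHS]mulr_natr; field.
have pi0 := pi_gt0 R.
have : 0 < sin h.
  apply: sin_gt0_pi; rewrite /h divr_gt0 ?mulr_gt0 ?ltr0n //=.
  by rewrite -mulrA gtr_pMr // ltr_pdivrMr // mul1r ltr_nat.
move=> s0; rewrite cos_mulr2n cos2sin2; apply/eqP => E.
by have := exprn_gt0 2 s0; lra.
Qed.

(** Fourier inversion: weight the [k]-th equation by $e^{k(t-i)}$, where $t-i$ stands for $-i$ in
    natural exponents, and sum over [k]; the geometric sums vanish off the class [i]. *)
Lemma sum_residue_class_eq0 (F : numFieldType) t (e : F) (I : finType) (b : I -> nat)
    (v : I -> F) : t.-primitive_root e ->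
  (forall k, (k < t)%N -> \sum_j e ^+ k ^+ b j * v j = 0) ->
  forall i, (i < t)%N -> \sum_(j | (b j %% t == i)%N) v j = 0.
Proof.
move=> pe H i lit.
have t0 : (t%:R : F) != 0 by rewrite pnatr_eq0; case: t lit {pe H}.
apply: (mulfI t0); rewrite mulr0 mulr_sumr.
have E0 : \sum_(k < t) \sum_j e ^+ k ^+ (t - i) * (e ^+ k ^+ b j * v j) = 0.
  by apply: big1 => k _; rewrite -mulr_sumr H ?mulr0.
rewrite -[RHS]E0 exchange_big /= [LHS]big_mkcond /=; apply: eq_bigr => j _.
under eq_bigr do rewrite mulrA -exprD -exprM mulnC exprM.
rewrite -mulr_suml; set y := e ^+ _.
have yt : y ^+ t = 1 by rewrite /y exprAC (prim_expr_order pe) expr1n.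
have y1 : (y == 1) = (b j %% t == i)%N.
  rewrite /y -(prim_order_dvd pe) /dvdn; apply/idP/idP.
    rewrite -modnDmr; have := ltn_pmod (b j) (leq_ltn_trans (leq0n _) lit).
    move=> lb E; have : (t %| (t - i + b j %% t))%N := E.
    case/dvdnP => -[|[|k]] Ek; last by lia.
      by lia.
    by lia.
  move/eqP => <-; rewrite -modnDmr subnK ?modnn //.
  by apply/ltnW/ltn_pmod/(leq_ltn_trans _ lit).
case: eqP y1 => [y1 <-|/eqP ny <-] /=.
  rewrite y1; under eq_bigr do rewrite expr1n.
  by rewrite sumr_const card_ord.
have -> : \sum_(k < t) y ^+ k = 0; last by rewrite mul0r.
apply: (@mulfI _ (y - 1)); first by rewrite subr_eq0.
by rewrite -subrX1 yt subrr mulr0.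
Qed.

(** Closed form of [spec_point]: position $t+2a$ carries $z_a$ and position $t+2a+1$ its inverse. *)
Definition spec_coord (F : fieldType) t (e : F) (z : nat -> F) (k : nat) : F :=
  if (k < t)%N then e ^+ k else
  if odd (k - t) then (z (k - t)./2)^-1 else z (k - t)./2.

(** This is $|2c-\tau|$, as at least one of the truncated differences is 0. *)
Definition dist (tau c : nat) : nat := (2 * c - tau + (tau - 2 * c))%N.

Lemma det0_col (F : fieldType) n (A : 'M[F]_n) : \det A = 0 ->
  exists2 v : 'I_n -> F, (exists j, v j != 0) & forall i, \sum_j A i j * v j = 0.
Proof.
rewrite -det_tr => /eqP/det0P[v v0 vA]; exists (v 0); first exact/rV0Pn.
move=> i; have /rowP/(_ i) := vA; rewrite !mxE => E; rewrite -[RHS]E.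
by apply: eq_bigr => j _; rewrite mxE mulrC.
Qed.

Lemma col_det0 (F : fieldType) n (A : 'M[F]_n) (v : 'I_n -> F) : (exists j, v j != 0) ->
  (forall i, \sum_j A i j * v j = 0) -> \det A = 0.
Proof.
move=> v0 vA; rewrite -det_tr; apply/eqP/det0P; exists (\row_j v j).
  by apply/rV0Pn; case: v0 => j vj; exists j; rewrite mxE.
apply/rowP => i; rewrite !mxE -[RHS](vA i); apply: eq_bigr => j _.
by rewrite !mxE mulrC.
Qed.

(* Replace z by z u^-2 and rescale column j by u^(dist tau (b j)); then set u = 0. *)
Lemma limit_kernel (F : numFieldType) t r (e : F) (b : 'I_(t + 2 * r) -> nat)
    (tau : nat) (y : nat -> nat) (z : nat -> F) :
  t.-primitive_root e ->
  (forall z, (forall a, z a != 0) ->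
     \det (\matrix_(k, j) spec_coord t e z k ^+ b j : 'M_(t + 2 * r)) = 0) ->
  (forall j, (y (b j %% t) <= dist tau (b j))%N) ->
  (forall a, z a != 0) ->
  exists x : 'I_(t + 2 * r) -> F, [/\ exists j, x j != 0,
    forall i, (i < t)%N ->
      \sum_(j | (b j %% t == i)%N && (dist tau (b j) == y i)) x j = 0,
    forall a, (a < r)%N -> \sum_(j | (tau <= 2 * b j)%N) z a ^+ b j * x j = 0 &
    forall a, (a < r)%N -> \sum_(j | (2 * b j <= tau)%N) (z a)^-1 ^+ b j * x j = 0].
Proof.
move=> pe H yP z0.
(* Class row [k] is also divided by $u^{y(k)}$, the row of $z_a$ multiplied by $u^{\tau}$ and that
   of its inverse by $u^{-\tau}$. All exponents of [u] become truncated differences, so the entries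
   are polynomials. *)
pose M : 'M[{poly F}]_(t + 2 * r) := \matrix_(k, j)
  if (k < t)%N then (if (b j %% t == k)%N then 'X^(dist tau (b j) - y k) else 0) else
  if odd (k - t) then ((z (k - t)./2)^-1 ^+ b j)%:P * 'X^(2 * (2 * b j - tau))
  else (z (k - t)./2 ^+ b j)%:P * 'X^(2 * (tau - 2 * b j)).
(* For $u\ne0$, a kernel vector of the specialized matrix, rescaled by $u^{-|2b_j-\tau|}$, is killed
   by $M(u)$. Hence the polynomial [\det M] is zero, and $M(0)$ is singular too. *)
have M0 : \det M = 0.
  apply: poly_eq_punctured => u u0.
  rewrite horner0 -horner_evalE -det_map_mx.
  have zu a : z a * u ^- 2 != 0 by rewrite mulf_neq0 // invr_eq0 expf_neq0.
  have /det0_col[v [j0 vj0] vA] := H _ zu.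
  apply: (@col_det0 _ _ _ (fun j => u ^- dist tau (b j) * v j)).
    by exists j0; rewrite mulf_neq0 // invr_eq0 expf_neq0.
  have uX k : u ^+ k != 0 by rewrite expf_neq0.
  move=> k; case: (ltnP k t) => [lkt|lek].
    rewrite (_ : \sum_j _ = u ^- y k * \sum_(j | (b j %% t == k)%N) v j); last first.
      rewrite mulr_sumr [RHS]big_mkcond /=; apply: eq_bigr => j _.
      rewrite !mxE /= lkt; case: eqP => [bk|_]; last by rewrite horner_evalE horner0 mul0r.
      rewrite horner_evalE hornerXn mulrA; congr (_ * _).
      have := yP j; rewrite bk => le; apply: (mulIf (uX (dist tau (b j)))).
      by rewrite mulfVK // -{2}(subnK le) exprD mulrCA mulVf // mulr1.
    rewrite (sum_residue_class_eq0 pe) ?mulr0 // => i lit.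
    have li : (i < t + 2 * r)%N by rewrite ltn_addr.
    have := vA (Ordinal li).
    rewrite (eq_bigr (fun j => e ^+ i ^+ b j * v j)) // => j _.
    by rewrite mxE /spec_coord lit.
  have {vA} := vA k; rewrite /= => E.
  rewrite (_ : \sum_j _ = (if odd (k - t) then u ^- tau else u ^+ tau) *
    (\sum_j (\matrix_(k, j) spec_coord t e (fun a => z a * u ^- 2) k ^+ b j
       : 'M_(t + 2 * r)) k j * v j)); last first.
    rewrite mulr_sumr; apply: eq_bigr => j _.
    rewrite !mxE /= /spec_coord ltnNge lek /= !mulrA; congr (_ * _).
    have uV : u \is a GRing.unit by rewrite unitfE.
    case: ifP => _; rewrite horner_evalE hornerM hornerC hornerXn.
      rewrite invfM invrK exprMn mulrCA -mulrA; congr (_ * _).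
      apply: (mulIf (uX (dist tau (b j)))); rewrite mulfVK //.
      apply: (mulfI (uX tau)); rewrite -!mulrA mulVKf // -!exprD -!exprM -exprD.
      by congr (_ ^+ _); rewrite /dist; lia.
    rewrite exprMn mulrCA -mulrA; congr (_ * _).
    apply: (mulIf (uX (dist tau (b j)))); rewrite mulfVK //.
    apply: (mulfI (uX (2 * b j)%N)); rewrite exprVn -exprM -mulrA.
    rewrite [X in _ = _ * X]mulrCA mulVKf // -!exprD.
    by congr (_ ^+ _); rewrite /dist; lia.
  by rewrite E mulr0.
have {M0} : \det (map_mx (horner_eval 0) M) = 0.
  by rewrite det_map_mx M0 rmorph0.
case/det0_col => x x0 xM; exists x; split=> //.
- move=> i lit; have li : (i < t + 2 * r)%N by rewrite ltn_addr.
  rewrite -[RHS](xM (Ordinal li)) big_mkcond /=; apply: eq_bigr => j _.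
  rewrite !mxE /= lit; case: eqP => [bi|_] /=; last by rewrite horner_evalE horner0 mul0r.
  rewrite horner_evalE hornerXn expr0n subn_eq0 eqn_leq.
  have := yP j; rewrite bi => ->; rewrite andbT.
  by case: leq; rewrite ?mul1r ?mul0r.
- move=> a lar; have la : (t + 2 * a < t + 2 * r)%N by lia.
  rewrite -[RHS](xM (Ordinal la)) big_mkcond /=; apply: eq_bigr => j _.
  rewrite !mxE /= ltnNge leq_addr addKn oddM /= (mul2n a) doubleK.
  rewrite horner_evalE hornerM hornerC hornerXn expr0n muln_eq0 /= subn_eq0.
  by case: leq; rewrite ?mulr1 ?mulr0 ?mul0r.
move=> a lar; have la : (t + (2 * a).+1 < t + 2 * r)%N by lia.
rewrite -[RHS](xM (Ordinal la)) big_mkcond /=; apply: eq_bigr => j _.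
rewrite !mxE /= ltnNge leq_addr addKn /= oddM /= (mul2n a) uphalf_double.
rewrite horner_evalE hornerM hornerC hornerXn expr0n muln_eq0 /= subn_eq0.
by case: leq; rewrite ?mulr1 ?mulr0 ?mul0r.
Qed.

End Kernel.

(** * From the Schur polynomial to the specialized alternant *)

Section SchurPoint.

Lemma meval_alternant (K : idomainType) N (a : 'I_N -> nat) (x : 'I_N -> K) :
  (alternant K a).@[x] = \det (\matrix_(k, j) x k ^+ a j : 'M_N).
Proof.
rewrite /alternant -det_map_mx; congr (\det _); apply/matrixP => i j.
by rewrite !mxE rmorphXn /= mevalXU.
Qed.

Lemma spec_pointE (R : realType) t r (z : nat -> R[i]) (k : 'I_(t + 2 * r)) :
  spec_point t (fun a : 'I_r => z a) k = spec_coord t (zeta R t) z k.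
Proof.
rewrite /spec_point /spec_coord nth_cat size_map size_iota.
case: ltnP => [lkt|lek]; first by rewrite (nth_map 0%N) ?size_iota // nth_iota.
have: (k - t < 2 * r)%N by have := ltn_ord k; lia.
rewrite -[X in (_ < 2 * X)%N](size_enum_ord r).
have -> : flatten [seq [:: z a; (z a)^-1] | a : 'I_r] =
    flatten [seq [:: z a; (z a)^-1] | a <- map val (enum 'I_r)].
  by rewrite -map_comp.
rewrite val_enum_ord size_enum_ord.
have aux m n i : (i < 2 * n)%N -> nth 0 (flatten [seq [:: z a; (z a)^-1] | a <- iota m n]) i =
    if odd i then (z (m + i./2)%N)^-1 else z (m + i./2)%N.
  elim: n m i => [|n IH] m [|[|i]] //= li; rewrite ?addn0 //.
  by rewrite IH ?addSnnS ?negbK //; lia.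
by move=> lt; rewrite aux.
Qed.

(** The bialternant formula is evaluated in its multiplied-out form, since the denominator may
    vanish at the point. *)
Lemma schur_vanish_det (R : realType) t r (lam : 'I_(t + 2 * r) -> nat) :
  (forall z : 'I_r -> R[i], (forall a, z a != 0) ->
       (schur R[i] lam).@[spec_point t z] = 0) ->
  forall z : nat -> R[i], (forall a, z a != 0) ->
  \det (\matrix_(k, j) spec_coord t (zeta R t) z k ^+ beta lam j : 'M_(t + 2 * r)) = 0.
Proof.
move=> H z z0.
have := congr1 (meval (spec_point t (fun a : 'I_r => z a))) (schurP R[i] lam).
rewrite mevalM H // mul0r meval_alternant => ->; congr (\det _).
by apply/matrixP => i j; rewrite !mxE spec_pointE.
Qed.

End SchurPoint.

(** * Position of the betas relative to a threshold *)

Section PairSums.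
Local Open Scope nat_scope.
Variable tau : nat.
Implicit Types (c : seq nat).

Definition pair_sums c := [seq nth 0 c k + nth 0 c k.+1 | k <- iota 0 (size c).-1].

Lemma pair_sums_cons x y c : pair_sums [:: x, y & c] = x + y :: pair_sums (y :: c).
Proof. by rewrite /pair_sums /= -[1]addn0 iotaDl -map_comp. Qed.

Lemma size_pair_sums c : size (pair_sums c) = (size c).-1.
Proof. by rewrite size_map size_iota. Qed.

(** Existence of a partner replaces adjacency in the sorted list, so that counts no longer depend on
    the order in which a class is listed. *)
Definition has_below (Q : pred nat) c x := has (fun d => (d < x) && Q (x + d)) c.
Definition has_above (Q : pred nat) c x := has (fun d => (x < d) && Q (x + d)) c.

Lemma sorted_gtnP x y c : sorted gtn [:: x, y & c] ->
  [/\ y < x, (forall d, d \in c -> d < y) & sorted gtn (y :: c)].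
Proof.
move=> /= /andP[yx pc]; split=> //= d dc.
have tr : transitive gtn by move=> u v w /= uv vw; apply: ltn_trans vw uv.
by have /allP/(_ d dc) := order_path_min tr pc.
Qed.

Lemma has_below_cons Q x c z : z < x -> has_below Q (x :: c) z = has_below Q c z.
Proof. by move=> zx; rewrite /has_below /= ltnNge ltnW. Qed.

(** Each consecutive sum is charged to its larger element. The successor is the largest smaller
    element, so some partner from below gives a sum above [tau] exactly when the successor does. *)
Lemma count_pair_sums_gt c : sorted gtn c ->
  count (fun s => tau < s) (pair_sums c) = count (has_below (fun s => tau < s) c) c.
Proof.
elim: c => [|x [|y c] IH] //; first by rewrite /has_below /= ltnn.
move=> /sorted_gtnP[yx ltc sc]; rewrite pair_sums_cons.
rewrite [LHS]/= IH // [RHS]/=; congr (nat_of_bool _ + _).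
  rewrite /has_below /= ltnn yx /=; apply/idP/idP => [->//|/orP[//|/hasP[d dc]]].
  by have := ltc d dc; lia.
apply: (@eq_in_count _ _ _ (y :: c)) => z zc.
rewrite [RHS](@has_below_cons _ x (y :: c)) //.
by move: zc; rewrite inE => /orP[/eqP->//|/ltc]; lia.
Qed.

Lemma count_pair_sums_eq c : sorted gtn c ->
  count (fun s => s == tau) (pair_sums c) =
  count (fun x => ~~ has_below (fun s => tau < s) c x && has_below (fun s => s == tau) c x) c.
Proof.
elim: c => [|x [|y c] IH] //; first by rewrite /has_below /= ltnn.
move=> /sorted_gtnP[yx ltc sc]; rewrite pair_sums_cons.
rewrite [LHS]/= IH // [RHS]/=; congr (nat_of_bool _ + _).
  rewrite /has_below /= ltnn yx /=; apply/idP/andP => [/eqP e|].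
    rewrite e eqxx ltnn; split=> //; apply/hasPn => d /ltc; lia.
  case=> /norP[nxy _] /orP[//|/hasP[d /ltc dy /andP[_ /eqP e]]].
  by move: nxy; rewrite -e -leqNgt leq_add2l leqNgt dy.
apply: (@eq_in_count _ _ _ (y :: c)) => z zc.
have zx : z < x by move: zc; rewrite inE => /orP[/eqP->//|/ltc]; lia.
by rewrite /has_below /= (ltnNge x z) (ltnW zx).
Qed.

(** Here each consecutive sum is charged to its smaller element, whose predecessor gives the least
    sum among partners from above. *)
Lemma count_pair_sums_lt c : sorted gtn c ->
  count (fun s => s < tau) (pair_sums c) = count (has_above (fun s => s < tau) c) c.
Proof.
have cE (q : pred nat) x s : count q (x :: s) = q x + count q s by [].
have h0 d s : (forall e, e \in s -> e <= d) -> has_above (fun s => s < tau) s d = false.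
  by move=> H; apply/hasPn => e /H; rewrite leqNgt => /negPf->.
elim: c => [|x [|y c] IH] //; first by rewrite /has_above /= ltnn.
move=> /sorted_gtnP[yx ltc sc]; rewrite pair_sums_cons.
rewrite cE IH // !cE (h0 x [:: x, y & c]) ?(h0 y (y :: c)); first last.
- by move=> e; rewrite !inE => /or3P[/eqP->|/eqP->|/ltc]; lia.
- by move=> e; rewrite !inE => /orP[/eqP->|/ltc]; lia.
rewrite !add0n; congr (nat_of_bool _ + _).
  rewrite /has_above /= ltnn yx /= [y + x]addnC.
  by case: (x + y < tau) => //=; apply/esym/hasPn => d /ltc; lia.
apply: eq_in_count => z zc; rewrite /has_above /=.
by have := ltc z zc; case: (has _ c); lia.
Qed.

End PairSums.

(** * Independence of power functions and Cramer's rule *)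

Section Indep.
Variable F : numFieldType.
Implicit Types (z : nat -> F) (U : seq nat) (f : nat -> int) (X : nat -> F).

(** A nonzero [X] on [U] would be a kernel vector of the generalized Vandermonde matrix at
    [pow2]. *)
Lemma pow2_independent r U f X : uniq U -> injective f -> (size U <= r)%N ->
  (forall a, (a < r)%N -> \sum_(c <- U) pow2 F a ^ f c * X c = 0) ->
  forall c, c \in U -> X c = 0.
Proof.
move=> uU fi sU H c cU; apply/eqP/negPn/negP => Xc.
have : alt (size U) (pow2 F) (map f U) != 0.
  by apply: alt_pow2_neq0; rewrite ?size_map ?map_inj_uniq.
rewrite /alt; set M := \matrix_(i, j) _; case/eqP.
apply: (@col_det0 _ _ _ (fun j => X (nth 0%N U j))).
  by have lc := cU; rewrite -index_mem in lc; exists (Ordinal lc); rewrite nth_index.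
move=> i; rewrite -[RHS](H i); last by apply: leq_trans sU.
rewrite (big_nth 0%N) big_mkord; apply: eq_bigr => j _.
by rewrite mxE (nth_map 0%N).
Qed.

(* Cramer's rule for the solution line of n+1 homogeneous equations in n+2 unknowns. *)
Lemma cramer_two z U f X a b :
  (forall i, (i <= size U)%N -> z i ^ f a * X a + z i ^ f b * X b +
     \sum_(c <- U) z i ^ f c * X c = 0) ->
  X a * alt (size U).+1 z (f a :: map f U) = - X b * alt (size U).+1 z (f b :: map f U).
Proof.
move=> H; set n := size U.
(* Identity matrix with first column replaced by the values of [X] on [a :: U]. It has determinant
   [X a], and multiplying by it turns the column of [a] into [- X b] times the column of [b]. *)
pose C : 'M[F]_n.+1 := \matrix_(i, j)
  if val j == 0%N then X (nth 0%N (a :: U) i) else (i == j)%:R.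
pose D : 'rV[F]_n.+1 := \row_j (if val j == 0%N then - X b else 1).
have -> : X a = \det C.
  rewrite det_trig; last first.
    apply/is_trig_mxP => i j lij; rewrite mxE (gtn_eqF (leq_ltn_trans (leq0n _) lij)).
    by rewrite -val_eqE (ltn_eqF lij).
  rewrite big_ord_recl mxE /= big1 ?mulr1 // => i _.
  by rewrite mxE /= eqxx.
have -> : - X b = \det (diag_mx D).
  rewrite det_diag big_ord_recl mxE /= big1 ?mulr1 // => i _.
  by rewrite mxE.
rewrite mulrC [RHS]mulrC /alt -!det_mulmx; congr (\det _).
apply/matrixP => i j; rewrite mul_mx_diag !mxE; case: j => -[|j] lj /=.
  have := H i (leq_ord i) => /eqP; rewrite addrAC addr_eq0 mulrN => /eqP<-.
  rewrite big_ord_recl !mxE /=; congr (_ + _).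
  rewrite (big_nth 0%N) big_mkord; apply: eq_bigr => k _.
  by rewrite !mxE lift0 /= (nth_map 0%N).
rewrite mulr1 (bigD1 (Ordinal lj)) //= big1 ?addr0 => [|k nk].
  by rewrite !mxE /= eqxx mulr1.
by rewrite !mxE /= (negPf nk) mulr0.
Qed.

End Indep.

(** * Sign types of the betas within their residue classes *)

Section Signs.
Variables (t tau : nat) (B : seq nat).
Implicit Types (c d e : nat).
Local Open Scope nat_scope.

Definition class_of i := [seq d <- B | d %% t == i].
Definition pos c := has_below (fun s => tau < s) (class_of (c %% t)) c.
Definition neg c := has_above (fun s => s < tau) (class_of (c %% t)) c.
(** [tie] marks the larger and [low] the smaller member of a pair $\{c,\tau-c\}$ of elements closest
    to $\tau/2$ in their class. *)
Definition tie c := ~~ pos c && has_below (fun s => s == tau) (class_of (c %% t)) c.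
Definition low c := ~~ neg c && has_above (fun s => s == tau) (class_of (c %% t)) c.

Lemma posP c : reflect (exists d, [/\ d \in B, d %% t = c %% t, d < c & tau < c + d]) (pos c).
Proof.
apply: (iffP hasP) => [[d]|[d [dB e lt s]]]; last first.
  by exists d; rewrite ?mem_filter ?e ?eqxx ?lt.
by rewrite mem_filter => /andP[/eqP e dB] /andP[]; exists d.
Qed.

Lemma negSP c : reflect (exists d, [/\ d \in B, d %% t = c %% t, c < d & c + d < tau]) (neg c).
Proof.
apply: (iffP hasP) => [[d]|[d [dB e lt s]]]; last first.
  by exists d; rewrite ?mem_filter ?e ?eqxx ?lt.
by rewrite mem_filter => /andP[/eqP e dB] /andP[]; exists d.
Qed.

Lemma tieP c : reflect [/\ ~~ pos c, c <= tau, tau - c \in B, (tau - c) %% t = c %% t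
   & tau - c < c] (tie c).
Proof.
apply: (iffP andP) => [[np /hasP[d]]|[np le dB e lt]].
  rewrite mem_filter => /andP[/eqP e dB] /andP[dc /eqP s].
  have -> : tau - c = d by lia.
  by split=> //; lia.
split=> //; apply/hasP; exists (tau - c); first by rewrite mem_filter e eqxx.
by rewrite lt subnKC ?eqxx.
Qed.

Lemma lowP c : reflect [/\ ~~ neg c, c <= tau, tau - c \in B, (tau - c) %% t = c %% t
   & c < tau - c] (low c).
Proof.
apply: (iffP andP) => [[np /hasP[d]]|[np le dB e lt]].
  rewrite mem_filter => /andP[/eqP e dB] /andP[dc /eqP s].
  have -> : tau - c = d by lia.
  by split=> //; lia.
split=> //; apply/hasP; exists (tau - c); first by rewrite mem_filter e eqxx.
by rewrite lt subnKC ?eqxx.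
Qed.

Lemma pos_gt c : pos c -> tau < 2 * c. Proof. by case/posP => d []; lia. Qed.
Lemma neg_lt c : neg c -> 2 * c < tau. Proof. by case/negSP => d []; lia. Qed.
Lemma tie_gt c : tie c -> tau < 2 * c. Proof. by case/tieP; lia. Qed.
Lemma low_lt c : low c -> 2 * c < tau. Proof. by case/lowP; lia. Qed.

Definition neutral c := ~~ pos c && ~~ neg c.

Lemma tie_low c : c \in B -> tie c -> low (tau - c).
Proof.
move=> cB /tieP[np le dB e lt]; apply/lowP; rewrite subKn // e; split=> //; try lia.
apply/negSP => -[d [dB' e' l1 l2]]; case/posP: np; exists d; split=> //; lia.
Qed.

Lemma low_tie c : c \in B -> low c -> tie (tau - c).
Proof.
move=> cB /lowP[np le dB e lt]; apply/tieP; rewrite subKn // e; split=> //; try lia.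
apply/posP => -[d [dB' e' l1 l2]]; case/negSP: np; exists d; split=> //; lia.
Qed.

Lemma tie_neutral c : tie c -> neutral c.
Proof.
move=> tc; rewrite /neutral (proj1 (andP tc)) /=; apply/negP => /neg_lt.
by have := tie_gt tc; lia.
Qed.

Lemma low_neutral c : low c -> neutral c.
Proof.
move=> tc; rewrite /neutral (proj1 (andP tc)) andbT; apply/negP => /pos_gt.
by have := low_lt tc; lia.
Qed.

(** A smaller [d] is closer to $\tau/2$ than [c] exactly when $c+d>\tau$, a larger one exactly when
    $c+d<\tau$. *)
Lemma neutralP c : c \in B -> reflect
  (forall d, d \in B -> d %% t = c %% t -> dist tau c <= dist tau d) (neutral c).
Proof.
move=> cB; apply: (iffP andP) => [[/posP np /negSP nn] d dB e|H].
  rewrite leqNgt; apply/negP; rewrite /dist => lt.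
  have [ldc|lcd|dc] := ltngtP d c; last by rewrite dc ltnn in lt.
    by apply: np; exists d; split=> //; lia.
  by apply: nn; exists d; split=> //; lia.
split; first by apply/posP => -[d [dB e l1 l2]]; have := H d dB e; rewrite /dist; lia.
by apply/negSP => -[d [dB e l1 l2]]; have := H d dB e; rewrite /dist; lia.
Qed.

(* Neutral elements of one class have equal |2c - tau|, so there are at most two. *)
Lemma neutral_class c d : c \in B -> d \in B -> neutral c -> neutral d ->
  d %% t = c %% t -> d = c \/ [/\ c + d = tau, tie c || low c & tie d || low d].
Proof.
move=> cB dB nc nd e; have := neutralP cB nc d dB e.
have := neutralP dB nd c cB (esym e) => l1 l2.
have: d = c \/ d != c /\ c + d = tau.
  by case: eqP => [|n]; [left|right]; rewrite ?/dist in l1 l2 *; lia.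
case=> [|[ndc s]]; [by left | right].
have ed : d = tau - c by lia.
have ec : c = tau - d by lia.
case/andP: nc nd => pc ngc /andP[pd ngd].
have [lt|lt|E] := ltngtP d c; last by rewrite E eqxx in ndc.
  split=> //; apply/orP; [left; apply/tieP|right; apply/lowP].
    by rewrite -ed; split=> //; lia.
  by rewrite -ec e; split=> //; lia.
split=> //; apply/orP; [right; apply/lowP|left; apply/tieP].
  by rewrite -ed; split=> //; lia.
by rewrite -ec e; split=> //; lia.
Qed.

End Signs.

(** * Solutions of the limit system *)

Section KernelAnalysis.
Variables (F : numFieldType) (t r tau : nat) (B : seq nat).
Hypothesis uB : uniq B.
Implicit Types (c d e : nat) (z : nat -> F) (X : nat -> F).
Notation pos := (pos t tau B).
Notation neg := (neg t tau B).
Notation tie := (tie t tau B).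
Notation low := (low t tau B).
Notation neutral := (neutral t tau B).

(** The limit system, with coefficients indexed by the betas themselves instead of their
    positions. *)
Definition kernel_sys z X := [/\ exists2 c, c \in B & X c != 0,
  forall c, c \in B -> \sum_(d <- B | (d %% t == c %% t)%N && neutral d) X d = 0,
  forall a, (a < r)%N -> \sum_(c <- B | (tau <= 2 * c)%N) z a ^+ c * X c = 0 &
  forall a, (a < r)%N -> \sum_(c <- B | (2 * c <= tau)%N) (z a)^-1 ^+ c * X c = 0].

(** The neutral elements in the class of [c] are exactly [c] and [tau - c]. *)
Lemma kernel_tie z X c : kernel_sys z X -> c \in B -> tie c -> X (tau - c)%N = - X c.
Proof.
case=> _ H _ _ cB tc; have /tieP[_ le dB e lt] := tc.
suff pc : perm_eq [seq d <- B | (d %% t == c %% t)%N && neutral d] [:: c; (tau - c)%N].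
  apply/eqP; rewrite -subr_eq0 opprK addrC; apply/eqP; rewrite -[RHS](H c cB).
  by rewrite -big_filter (perm_big _ pc) !big_cons big_nil /= addr0.
apply: uniq_perm; rewrite ?filter_uniq //= ?inE ?andbT ?(gtn_eqF lt) // => d.
rewrite !inE mem_filter; apply/idP/idP => [|/orP[]/eqP->]; last 2 first.
- by rewrite eqxx cB (tie_neutral tc).
- by rewrite e eqxx dB (low_neutral (tie_low cB tc)).
case/andP=> /andP[/eqP ed nd] dB'.
have [->|[s _ _]] := neutral_class cB dB' (tie_neutral tc) nd ed; first by rewrite eqxx.
by apply/orP; right; apply/eqP; lia.
Qed.

Lemma kernel_lone z X c : kernel_sys z X -> c \in B -> neutral c -> ~~ tie c -> ~~ low c ->
  X c = 0.
Proof.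
case=> _ H _ _ cB nc ntc nlc.
suff pc : perm_eq [seq d <- B | (d %% t == c %% t)%N && neutral d] [:: c].
  by rewrite -[RHS](H c cB) -big_filter (perm_big _ pc) big_cons big_nil /= addr0.
apply: uniq_perm; rewrite ?filter_uniq // => d.
rewrite !inE mem_filter; apply/idP/eqP => [|->]; last by rewrite eqxx cB nc.
case/andP=> /andP[/eqP ed nd] dB'.
have [//|[s]] := neutral_class cB dB' nc nd ed.
by rewrite (negPf ntc) (negPf nlc).
Qed.

Lemma kernel_low z X c : kernel_sys z X -> c \in B -> low c -> X c = - X (tau - c)%N.
Proof.
move=> K cB lc; have /lowP[_ le dB _ _] := lc.
by rewrite -(kernel_tie K dB (low_tie cB lc)) subKn.
Qed.

(** An element with $2c\ge\tau$ that is neither [pos] nor [tie] is the only neutral one of its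
    class, so its coefficient is 0. *)
Lemma kernel_pos_sum z X a : kernel_sys z X -> (a < r)%N ->
  \sum_(c <- [seq c <- B | tie c] ++ [seq c <- B | pos c]) z a ^ c%:Z * X c = 0.
Proof.
move=> K lar; case: (K) => _ _ H _; rewrite -[RHS](H a lar).
rewrite big_cat /= !big_filter big_mkcond [X in _ + X]big_mkcond [RHS]big_mkcond /=.
rewrite -big_split; apply: eq_big_seq => c cB /=.
case tc : (tie c).
  have := tie_gt tc; case/tieP: tc => /negPf -> _ _ _ _ lt.
  by rewrite addr0 ifT //; lia.
case pc : (pos c); first by rewrite add0r ifT //; have := pos_gt pc; lia.
rewrite add0r; case: ifP => // le; rewrite (kernel_lone K) ?mulr0 ?tc //.
  by rewrite /neutral pc; apply/negP => /neg_lt; lia.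
by apply/negP => /low_lt; lia.
Qed.

Lemma kernel_neg_sum z X a : kernel_sys z X -> (a < r)%N ->
  \sum_(c <- [seq c <- B | low c] ++ [seq c <- B | neg c]) z a ^ (- c%:Z) * X c = 0.
Proof.
move=> K lar; case: (K) => _ _ _ H; rewrite -[RHS](H a lar).
rewrite big_cat /= !big_filter big_mkcond [X in _ + X]big_mkcond [RHS]big_mkcond /=.
rewrite -big_split; apply: eq_big_seq => c cB /=.
have -> : z a ^ (- c%:Z) = (z a)^-1 ^+ c by rewrite exprVn -exprnN.
case tc : (low c).
  have := low_lt tc; case/lowP: tc => /negPf -> _ _ _ _ lt.
  by rewrite addr0 ifT //; lia.
case pc : (neg c); first by rewrite add0r ifT //; have := neg_lt pc; lia.
rewrite add0r; case: ifP => // le; rewrite (kernel_lone K) ?mulr0 ?tc //.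
  by rewrite /neutral pc andbT; apply/negP => /pos_gt; lia.
by apply/negP => /tie_gt; lia.
Qed.

Lemma tie_pos_uniq : uniq ([seq c <- B | tie c] ++ [seq c <- B | pos c]).
Proof.
rewrite cat_uniq !filter_uniq //= andbT; apply/hasPn => c.
by rewrite !mem_filter => /andP[pc _]; rewrite /tie pc.
Qed.

(** Otherwise independence at [pow2] kills [X] on [tie] and [pos], hence on [low], then on [neg];
    the remaining neutral elements carry 0 anyway, against [X] being nonzero. *)
Lemma kernel_count_gt X : kernel_sys (pow2 F) X ->
  (count neg B <= r)%N -> (r < count tie B + count pos B)%N.
Proof.
move=> K sN; rewrite ltnNge; apply/negP => sP.
have X0 : forall c, c \in B -> tie c || pos c -> X c = 0.
  move=> c cB tpc; apply: (@pow2_independent _ r _ Posz X tie_pos_uniq).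
  - by move=> ? ? [].
  - by rewrite size_cat !size_filter.
  - by move=> a lar; apply: kernel_pos_sum K lar.
  by rewrite mem_cat !mem_filter cB !andbT.
have L0 c : c \in B -> low c -> X c = 0.
  move=> cB lc; have /lowP[_ _ dB _ _] := lc.
  by rewrite (kernel_low K cB lc) X0 ?oppr0 // low_tie.
have N0 : forall c, c \in [seq c <- B | neg c] -> X c = 0.
  move=> c cN; apply: (@pow2_independent _ r _ (fun c => - c%:Z) X _ _ _ _ _ cN).
  - exact: filter_uniq.
  - by move=> i j /oppr_inj[].
  - by rewrite size_filter.
  move=> a lar; rewrite -[RHS](kernel_neg_sum K lar) big_cat /= [X in X + _]big1_seq ?add0r //.
  by move=> d; rewrite mem_filter => /= /andP[ld dB]; rewrite L0 ?mulr0.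
case: (K) => -[c cB] /negP[]; apply/eqP.
have [nc|] := boolP (neutral c).
  have [|nt] := boolP (tie c); first by move=> tc; apply: X0; rewrite ?tc.
  have [|nl] := boolP (low c); first exact: L0.
  exact: kernel_lone K cB nc nt nl.
rewrite negb_and !negbK => /orP[] h; first by rewrite X0 // h orbT.
by rewrite N0 // mem_filter h.
Qed.

(** The columns of [U] are already dependent: pad the relation with coefficient 0 for [e]. *)
Lemma alt_dependent z (U : seq nat) (f : nat -> int) X (e : int) c :
  (forall i, (i <= size U)%N -> \sum_(d <- U) z i ^ f d * X d = 0) ->
  c \in U -> X c != 0 -> alt (size U).+1 z (e :: map f U) = 0.
Proof.
move=> H cU Xc.
apply: (@col_det0 _ _ _ (fun j => if j : nat is k.+1 then X (nth 0%N U k) else 0)).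
  have lc := cU; rewrite -index_mem in lc.
  by exists (lift ord0 (Ordinal lc)); rewrite lift0 nth_index.
move=> i; rewrite big_ord_recl mulr0 add0r -[RHS](H i (leq_ord i)).
rewrite (big_nth 0%N) big_mkord; apply: eq_bigr => k _.
by rewrite !mxE lift0 /= (nth_map 0%N).
Qed.

Lemma low_perm_tie : perm_eq [seq c <- B | low c] [seq (tau - c)%N | c <- [seq c <- B | tie c]].
Proof.
apply: uniq_perm; first exact: filter_uniq.
  rewrite map_inj_in_uniq ?filter_uniq // => c d; rewrite !mem_filter.
  by case/andP=> /tieP[_ lc _ _ _] _ /andP[/tieP[_ ld _ _ _] _]; lia.
move=> c; rewrite mem_filter; apply/andP/mapP => [[lc cB]|[d]].
  have /lowP[_ le dB _ _] := lc.
  by exists (tau - c)%N; rewrite ?subKn // mem_filter low_tie.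
rewrite mem_filter => /andP[td dB ->]; split; first exact: tie_low.
by case/tieP: td.
Qed.

(** The equations above and below $\tau/2$ each give a proportionality by Cramer's rule, both with
    coefficients [X a] and [- X b]; these coefficients are then eliminated. *)
Lemma kernel_altrel n a b : r = n.+1 ->
  (forall z, (forall i, z i != 0) -> exists X, kernel_sys z X) ->
  [seq c <- B | tie c] = [:: a; b] -> count pos B = n -> count neg B = n ->
  let P := [seq c%:Z | c <- B & pos c] in
  let Q := [seq tau%:Z - c%:Z | c <- B & neg c] in
  altrel F n.+1 (a%:Z :: P) (b%:Z :: Q) (b%:Z :: P) (a%:Z :: Q).
Proof.
move=> rn K AE cp cn P Q z z0; have [X KX] := K z z0.
congr (_ ^+ 2).
set Pl := [seq c <- B | pos c] in P *; set Ql := [seq c <- B | neg c] in Q *.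
have sP : size Pl = n by rewrite size_filter.
have sQ : size Ql = n by rewrite size_filter.
have inA c : c \in [:: a; b] -> [/\ c \in B, tie c & (c <= tau)%N].
  by rewrite -AE mem_filter => /andP[tc cB]; case/tieP: (tc).
have [aB ta la] := inA a (mem_head _ _).
have [bB tb lb] := inA b (mem_last a [:: b]).
have posE i : (i <= n)%N -> z i ^ a%:Z * X a + z i ^ b%:Z * X b +
    \sum_(c <- Pl) z i ^ c%:Z * X c = 0.
  move=> li; rewrite -[RHS](@kernel_pos_sum z X i KX) ?rn //.
  by rewrite AE big_cat /= !big_cons big_nil addr0.
(* Multiplying the lower equations by $z_i^{\tau}$ turns exponent $-c$ into $\tau-c$, so the low
   elements reappear with exponents [a] and [b]. *)
pose f c : int := tau%:Z - c%:Z.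
have negE i : (i <= n)%N -> z i ^ a%:Z * - X a + z i ^ b%:Z * - X b +
    \sum_(c <- Ql) z i ^ f c * X c = 0.
  move=> li; rewrite -[RHS](mulr0 (z i ^ tau%:Z)) -[in RHS](@kernel_neg_sum z X i KX) ?rn //.
  have fE c : z i ^ f c = z i ^ tau%:Z * z i ^ (- c%:Z) by rewrite /f expfzDr.
  rewrite big_cat /= (perm_big _ low_perm_tie) AE /= !big_cons big_nil addr0 mulrDr mulr_sumr.
  congr (_ + _); last by apply: eq_bigr => c _; rewrite mulrA fE.
  by rewrite !(kernel_tie KX) // mulrDr !mulrA -!fE /f -!subzn // !subKr.
have DE : X a * alt n.+1 z (a%:Z :: P) = - X b * alt n.+1 z (b%:Z :: P).
  by rewrite -sP; apply: cramer_two; rewrite sP.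
have EE : X a * alt n.+1 z (a%:Z :: Q) = - X b * alt n.+1 z (b%:Z :: Q).
  have fa : f (tau - a)%N = a%:Z by rewrite /f -subzn // subKr.
  have fb : f (tau - b)%N = b%:Z by rewrite /f -subzn // subKr.
  have := @cramer_two _ z Ql f X (tau - a)%N (tau - b)%N.
  rewrite sQ fa fb !(kernel_tie KX) // => /(_ negE)/eqP.
  by rewrite mulNr eqr_oppLR -mulNr opprK => /eqP.
have [Xa|Xa] := eqVneq (X a) 0; last first.
  by apply: (mulfI Xa); rewrite !mulrA DE [X a * _ * _]mulrAC EE; ring.
have [Xb|Xb] := eqVneq (X b) 0; last first.
  by apply: (mulfI (_ : - X b != 0)); rewrite ?oppr_eq0 // [RHS]mulrA -DE mulrCA -EE; ring.
(* If [X a = X b = 0], then [X] is nonzero somewhere on [pos] or [neg], and the alternants on that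
   side all vanish. *)
have X0 c : tie c || low c -> c \in B -> X c = 0.
  have tie0 d : tie d -> d \in B -> X d = 0.
    move=> td dB; have : d \in [:: a; b] by rewrite -AE mem_filter td.
    by rewrite !inE => /orP[]/eqP->.
  case/orP=> [|lc] cB; first by move/tie0; apply.
  rewrite (kernel_low KX) // tie0 ?oppr0 ?low_tie //.
  by case/lowP: lc.
have [c cB Xc] : exists2 c, c \in B & X c != 0 by case: KX.
have: (c \in Pl) || (c \in Ql).
  rewrite !mem_filter cB !andbT; apply: contraNT Xc => /norP[np nn].
  have [tl|/norP[nt nl]] := boolP (tie c || low c); first by rewrite X0.
  by rewrite (kernel_lone KX cB _ nt nl) // /neutral np.
case/orP=> cin.
  have D0 (e : int) : alt n.+1 z (e :: P) = 0.
    rewrite -sP; apply: alt_dependent cin Xc; rewrite sP => i /posE.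
    by rewrite Xa Xb !mulr0 !add0r.
  by rewrite !D0 !mul0r.
have D0 (e : int) : alt n.+1 z (e :: Q) = 0.
  rewrite -sQ; apply: alt_dependent cin Xc; rewrite sQ => i /negE.
  by rewrite Xa Xb !oppr0 !mulr0 !add0r.
by rewrite !D0 !mulr0.
Qed.

Lemma kernel_symmetric n a b : r = n.+1 ->
  (forall z, (forall i, z i != 0) -> exists X, kernel_sys z X) ->
  [seq c <- B | tie c] = [:: a; b] -> count pos B = n -> count neg B = n ->
  perm_eq [seq c%:Z | c <- B & pos c] [seq tau%:Z - c%:Z | c <- B & neg c].
Proof.
move=> rn K AE cp cn; have H := kernel_altrel rn K AE cp cn.
have inA c : c \in [:: a; b] -> [/\ c \in B, tie c & (c <= tau)%N].
  by rewrite -AE mem_filter => /andP[tc cB]; case/tieP: (tc).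
have uP : uniq [seq c%:Z | c <- B & pos c].
  by rewrite map_inj_uniq ?filter_uniq // => ? ? [].
have uQ : uniq [seq tau%:Z - c%:Z | c <- B & neg c].
  by rewrite map_inj_uniq ?filter_uniq // => ? ? /addrI/oppr_inj[].
have nP c : c \in [:: a; b] -> uniq (c%:Z :: [seq c%:Z | c <- B & pos c]).
  case/inA=> _ tc _; rewrite cons_uniq uP andbT; apply/mapP => -[d].
  by rewrite mem_filter => /andP[pd _] [cd]; move: tc; rewrite /tie cd pd.
have nQ c : c \in [:: a; b] -> uniq (c%:Z :: [seq tau%:Z - c%:Z | c <- B & neg c]).
  case/inA=> cB tc lc; rewrite cons_uniq uQ andbT; apply/mapP => -[d].
  rewrite mem_filter => /andP[nd _] e; have := tie_low cB tc.
  have -> : (tau - c)%N = d by lia.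
  by rewrite /low nd.
have := @altrel_unique F n a%:Z b%:Z _ _ _ _ _ _ _ _ _ H.
apply; rewrite ?size_map ?size_filter ?nP ?nQ ?inE ?eqxx ?orbT //.
have := filter_uniq tie uB; rewrite AE /= inE andbT.
by apply: contraNneq => -[->].
Qed.

End KernelAnalysis.

(** * Minimal distances in a class and the limit system on the betas *)

Section MinDist.
Variables (t tau : nat) (B : seq nat).
Local Open Scope nat_scope.

Definition min_dist i := head 0 (sort leq [seq dist tau c | c <- class_of t B i]).

Lemma min_distP i c : c \in class_of t B i ->
  (min_dist i \in [seq dist tau c | c <- class_of t B i]) /\
  forall d, d \in class_of t B i -> min_dist i <= dist tau d.
Proof.
move=> ci; rewrite /min_dist; set s := map _ _.
have ms : dist tau c \in s by apply: map_f.
have := sort_sorted leq_total s; have := mem_sort leq s.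
case: (sort leq s) => [/(_ (dist tau c))|m s' /= E srt]; first by rewrite ms.
split; first by rewrite -E mem_head.
move=> d di; have := map_f (dist tau) di; rewrite -/s -E inE => /orP[/eqP->//|].
have /allP H := order_path_min leq_trans srt.
exact: H.
Qed.

Lemma min_dist_le c : c \in B -> min_dist (c %% t) <= dist tau c.
Proof.
move=> cB; have cc : c \in class_of t B (c %% t) by rewrite mem_filter eqxx.
by have [_ ->] := min_distP cc.
Qed.

Lemma min_dist_neutral c : c \in B ->
  (dist tau c == min_dist (c %% t)) = neutral t tau B c.
Proof.
move=> cB; have cc : c \in class_of t B (c %% t) by rewrite mem_filter eqxx.
have [/mapP[m]] := min_distP cc; rewrite mem_filter => /andP[/eqP me mB] mE le.
apply/eqP/(@neutralP t tau B c cB) => [-> d dB de|H].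
  by apply: le; rewrite mem_filter de eqxx.
by apply/eqP; rewrite eqn_leq le // mE H.
Qed.

End MinDist.

(** The limit is taken with [y] the minimal distance of each class, so the elements surviving in a
    class row are the neutral ones. *)
Lemma limit_kernel_sys (F : numFieldType) t r (e : F) (b : 'I_(t + 2 * r) -> nat)
    (tau : nat) (z : nat -> F) : injective b ->
  t.-primitive_root e ->
  (forall z, (forall a, z a != 0) ->
     \det (\matrix_(k, j) spec_coord t e z k ^+ b j : 'M_(t + 2 * r)) = 0) ->
  (forall a, z a != 0) ->
  exists X, kernel_sys t r tau [seq b j | j : 'I_(t + 2 * r)] z X.
Proof.
move=> bi pe H z0; set B := [seq b j | j : _].
have bB j : b j \in B by apply: image_f.
have t0 := prim_order_gt0 pe.
have [x [[j0 xj0] x1 x2 x3]] := limit_kernel pe H (fun j => min_dist_le t tau (bB j)) z0.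
pose X c := \sum_(j | b j == c) x j.
have XE j : X (b j) = x j by rewrite /X (big_pred1 j) // => k; rewrite (inj_eq bi).
exists X; split.
- by exists (b j0); rewrite ?XE.
- move=> c cB; rewrite big_image_cond /= -[RHS](x1 (c %% t)%N) ?ltn_pmod //.
  apply: eq_big => [j|j _]; last exact: XE.
  by case: eqP => //= <-; rewrite min_dist_neutral.
- move=> a la; rewrite big_image_cond -[RHS](x2 a la) /=.
  by apply: eq_bigr => j _; rewrite XE.
move=> a la; rewrite big_image_cond -[RHS](x3 a la) /=.
by apply: eq_bigr => j _; rewrite XE.
Qed.

Lemma sorted_geq_nth_count (s : seq nat) k : (k < size s)%N -> sorted geq s ->
  (count (fun x => nth 0 s k < x) s <= k)%N /\ (k < count (fun x => nth 0 s k <= x) s)%N.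
Proof.
move=> lk ss; set x := nth 0%N s k.
have mono i j : (i <= j)%N -> (j < size s)%N -> (nth 0 s j <= nth 0 s i)%N.
  move=> ij lj; apply: (@sorted_leq_nth _ geq _ _ 0%N s ss) => //.
  - by move=> u v w /= uv vw; apply: leq_trans vw uv.
  - exact: leqnn.
  - exact: leq_ltn_trans ij lj.
split.
  rewrite -[X in count _ X](cat_take_drop k s) count_cat.
  have -> : count (fun y => x < y)%N (drop k s) = 0%N.
    apply/eqP; rewrite -leqn0 leqNgt -has_count; apply/hasPn => y /(nthP 0%N)[j].
    rewrite size_drop => lj <-; rewrite nth_drop -leqNgt; apply: mono; first exact: leq_addr.
    by rewrite -ltn_subRL.
  by rewrite addn0 (leq_trans (count_size _ _)) // size_take lk.
rewrite -[X in count _ X](cat_take_drop k.+1 s) count_cat ltn_addr //.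
have -> : count (fun y => x <= y)%N (take k.+1 s) = size (take k.+1 s).
  apply/eqP; rewrite -all_count; apply/(all_nthP 0%N) => i li.
  have lik : (i < k.+1)%N by move: li; rewrite size_take; case: ifP => //; lia.
  by rewrite nth_take //; apply: mono.
by rewrite size_take; case: ifP => //; lia.
Qed.

Lemma double_congr t i j : (i < t)%N -> (j < t)%N -> (i < j)%N ->
  (2 * i = 2 * j %[mod t])%N -> (2 * j = 2 * i + t)%N.
Proof.
move=> it jt ij /eqP; rewrite eq_sym eqn_mod_dvd; last by lia.
by case/dvdnP => -[|[|k]]; lia.
Qed.

(** * At most two ties *)

Section Ties.
Variables (t tau : nat) (B : seq nat).
Local Open Scope nat_scope.
Notation tie := (tie t tau B).

Lemma tie_residue_inj c d : c \in B -> d \in B -> tie c -> tie d -> c %% t = d %% t -> c = d.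
Proof.
move=> cB dB tc td e.
have [//|[s _ _]] := neutral_class dB cB (tie_neutral td) (tie_neutral tc) e.
by have := tie_gt tc; have := tie_gt td; lia.
Qed.

Lemma tie_congr c : tie c -> 2 * (c %% t) = tau %[mod t].
Proof. by case/tieP=> _ le _ e _; rewrite -[in RHS](subnK le) -[RHS]modnDm e addnn -mul2n. Qed.

Hypothesis uB : uniq B.

(** Ties have distinct residues, all solving $2x\equiv\tau\pmod t$. Two solutions in $[0,t)$ differ
    by exactly $t/2$, which leaves no room for a third. *)
Lemma ties_le2 : 0 < t -> count tie B <= 2 /\ (count tie B = 2 -> ~~ odd t).
Proof.
move=> t0.
have ltt c : c %% t < t by rewrite ltn_pmod.
have two c d : c \in B -> d \in B -> tie c -> tie d -> c != d ->
    2 * (c %% t) = 2 * (d %% t) + t \/ 2 * (d %% t) = 2 * (c %% t) + t.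
  move=> cB dB tc td ncd.
  have E : 2 * (c %% t) = 2 * (d %% t) %[mod t] by rewrite !tie_congr.
  have [lt|lt|e] := ltngtP (c %% t) (d %% t).
  - by right; apply: double_congr E.
  - by left; apply: double_congr (esym E).
  - by rewrite (tie_residue_inj cB dB tc td e) eqxx in ncd.
have inA c : c \in [seq c <- B | tie c] -> c \in B /\ tie c.
  by rewrite mem_filter => /andP[].
have := filter_uniq tie uB; rewrite -size_filter.
case: [seq _ <- _ | _] inA => [|c [|d [|e s]]] //= inA.
  rewrite inE andbT => ncd; split=> // _.
  have [cB tc] := inA c (mem_head _ _).
  have [dB td] : d \in B /\ tie d by apply: inA; rewrite !inE eqxx orbT.
  by have := two c d cB dB tc td ncd; lia.
rewrite !inE !negb_or => /and3P[/and3P[ncd nce _] /andP[nde _] _].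
have [cB tc] := inA c (mem_head _ _).
have [dB td] : d \in B /\ tie d by apply: inA; rewrite !inE eqxx orbT.
have [eB te] : e \in B /\ tie e by apply: inA; rewrite !inE eqxx !orbT.
have h1 := two c d cB dB tc td ncd; have h2 := two c e cB eB tc te nce.
have h3 := two d e dB eB td te nde; have := ltt c; have := ltt d; have := ltt e.
lia.
Qed.

End Ties.

(** * Counting the sums Delta *)

Section Betas.
Variables (t r : nat) (lam : 'I_(t + 2 * r) -> nat).
Local Open Scope nat_scope.
Hypothesis lam_dec : forall i j : 'I_(t + 2 * r), i <= j -> lam j <= lam i.
Hypothesis n_ge1 : forall i : nat, i < t -> 1 <= n_ lam i.
Hypothesis t0 : 0 < t.

Definition betas : seq nat := [seq beta lam j | j : 'I_(t + 2 * r)].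
Local Notation B := betas.
Local Notation E := (calE lam).
Local Notation S := (calS lam).

Lemma beta_inj : injective (beta lam).
Proof using lam_dec.
clear -lam_dec.
have lt (i j : 'I_(t + 2 * r)) : i < j -> beta lam j < beta lam i.
  move=> ij; rewrite /beta; have := lam_dec (ltnW ij); have := ltn_ord j; lia.
move=> i j e; apply: val_inj => /=.
by have [/lt|/lt|//] := ltngtP i j; rewrite e ltnn.
Qed.

Lemma uniq_betas : uniq B.
Proof. by rewrite map_inj_uniq ?enum_uniq //; apply: beta_inj. Qed.

Lemma size_betas : size B = t + 2 * r.
Proof. by rewrite size_map -cardE card_ord. Qed.

Lemma size_class_of i : size (class_of t B i) = n_ lam i.
Proof.
by rewrite /class_of size_filter -sum1_count big_image_cond /n_ cardsE -sum1_card.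
Qed.

Lemma mem_calE i : (i \in E) = (i < t) && (1 < n_ lam i).
Proof. by rewrite !inE /= mem_iota add0n andbC. Qed.

Lemma mem_calS x : (x \in S) = (x \in B) && (x %% t \in E).
Proof. by rewrite !inE. Qed.

Lemma calSP x : reflect (x \in B /\ exists2 d, d \in B & d != x /\ d %% t = x %% t) (x \in S).
Proof.
rewrite mem_calS mem_calE ltn_pmod //= -size_class_of.
apply: (iffP andP) => [[xB l2]|[xB [d dB [ndx e]]]]; split=> //.
  have xc : x \in class_of t B (x %% t) by rewrite mem_filter eqxx.
  have : 0 < size (rem x (class_of t B (x %% t))) by rewrite size_rem // -subn1 subn_gt0.
  case E' : (rem _ _) => [//|d s] _.
  have : d \in rem x (class_of t B (x %% t)) by rewrite E' mem_head.
  rewrite mem_rem_uniq ?filter_uniq ?uniq_betas // inE mem_filter.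
  by case/andP=> ndx /andP[/eqP e dB]; exists d.
have -> : 2 = size [:: x; d] by [].
apply: uniq_leq_size; first by rewrite /= inE eq_sym ndx.
by move=> y; rewrite !inE mem_filter => /orP[]/eqP->; rewrite ?e eqxx.
Qed.

Lemma mem_res_class A i x : (x \in res_class t A i) = (x \in A) && (x %% t == i).
Proof. by rewrite !inE. Qed.

Lemma class_perm i : i \in E ->
  perm_eq (dec_seq (res_class t S i)) (class_of t B i).
Proof.
move=> iE; rewrite /dec_seq perm_sort; apply: uniq_perm;
  rewrite ?fset_uniq ?filter_uniq ?uniq_betas // => x.
rewrite mem_res_class mem_filter mem_calS.
by case: eqP => [->|]; rewrite ?andbF // iE !andbT.
Qed.

Lemma dec_seq_sorted A : sorted gtn (dec_seq A).
Proof.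
by rewrite gtn_sorted_uniq_geq sort_uniq fset_uniq sort_sorted // => x y; apply: leq_total.
Qed.

Definition all_Delta := flatten [seq Delta lam i | i <- E].

Lemma DeltaE i : Delta lam i = pair_sums (dec_seq (res_class t S i)).
Proof. by []. Qed.

Lemma sum_count_classes (q : pred nat) :
  (forall x, x \in B -> q x -> x %% t \in E) ->
  \sum_(i <- E) count q (class_of t B i) = count q B.
Proof.
move=> qE; rewrite -sum1_count.
have -> : \sum_(x <- B | q x) 1 = \sum_(x <- B | q x) \sum_(i <- E | i == x %% t) 1.
  rewrite big_seq_cond [RHS]big_seq_cond; apply: eq_bigr => x /andP[xB qx].
  by rewrite sum1_count (count_uniq_mem _ (fset_uniq _)) qE.
rewrite (exchange_big_dep predT) //=; apply: eq_bigr => i _.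
rewrite sum1_count /class_of count_filter; apply: eq_count => x /=.
by rewrite eq_sym.
Qed.

(** Glues the class counts together. [qc] must ignore the order of its list, since a class is sorted
    in [Delta] but not in [class_of]. *)
Lemma count_Delta (p q : pred nat) (qc : seq nat -> pred nat) :
  (forall c, sorted gtn c -> count p (pair_sums c) = count (qc c) c) ->
  (forall c d, c =i d -> qc c =1 qc d) ->
  (forall x, q x = qc (class_of t B (x %% t)) x) ->
  (forall x, x \in B -> q x -> x %% t \in E) ->
  count p all_Delta = count q B.
Proof.
move=> cnt ext qE qin; rewrite count_flatten sumnE !big_map -(sum_count_classes qin).
apply: eq_big_seq => i iE /=.
rewrite DeltaE cnt ?dec_seq_sorted // (seq.permP (class_perm iE)).
apply: eq_in_count => x; rewrite mem_filter => /andP[/eqP xi _].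
by rewrite qE xi; apply: ext; apply: perm_mem (class_perm iE).
Qed.

Section Tau.
Variable tau : nat.

Lemma nonlone_calS d x : d \in B -> d %% t = x %% t -> d != x -> x \in B -> x %% t \in E.
Proof.
move=> dB e ndx xB; have : x \in S by apply/calSP; split=> //; exists d.
by rewrite mem_calS => /andP[].
Qed.

Lemma count_Delta_gt : count (fun s => tau < s) all_Delta = count (pos t tau B) B.
Proof.
apply: (@count_Delta _ _ (has_below (fun s => tau < s))) => //.
- by move=> c; apply: count_pair_sums_gt.
- by move=> c d cd x; apply: eq_has_r.
by move=> x xB /posP[d [dB e lt _]]; apply: nonlone_calS dB e _ xB; lia.
Qed.

Lemma count_Delta_lt : count (fun s => s < tau) all_Delta = count (neg t tau B) B.
Proof.
apply: (@count_Delta _ _ (has_above (fun s => s < tau))) => //.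
- by move=> c; apply: count_pair_sums_lt.
- by move=> c d cd x; apply: eq_has_r.
by move=> x xB /negSP[d [dB e lt _]]; apply: nonlone_calS dB e _ xB; lia.
Qed.

Lemma count_Delta_eq : count (fun s => s == tau) all_Delta = count (tie t tau B) B.
Proof.
apply: (@count_Delta _ _ (fun c x => ~~ has_below (fun s => tau < s) c x &&
   has_below (fun s => s == tau) c x)) => //.
- by move=> c; apply: count_pair_sums_eq.
- by move=> c d cd x; congr (~~ _ && _); apply: eq_has_r.
by move=> x xB /tieP[_ le dB e lt]; apply: nonlone_calS dB e _ xB; lia.
Qed.

End Tau.

(** Over all [t] classes the sum of $n_i-1$ is $N-t=2r$, and classes outside $\mathcal{E}$ have
    $n_i=1$. *)
Lemma sum_calE_pred : \sum_(i <- E) (n_ lam i).-1 = 2 * r.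
Proof.
have sn : \sum_(i < t) n_ lam i = t + 2 * r.
  rewrite -size_betas -sum1_size.
  have -> : \sum_(x <- B) 1 = \sum_(x <- B) \sum_(i < t | val i == x %% t) 1.
    by apply: eq_bigr => x _; rewrite (big_pred1 (Ordinal (ltn_pmod x t0))).
  rewrite (exchange_big_dep predT) //=; apply: eq_bigr => i _.
  rewrite -size_class_of sum1_count size_filter; apply: eq_count => x /=.
  by rewrite eq_sym.
have -> : \sum_(i <- E) (n_ lam i).-1 = \sum_(i < t) (n_ lam i).-1.
  rewrite -(big_mkord predT (fun i => (n_ lam i).-1)) /=.
  rewrite [RHS](bigID (fun i => 1 < n_ lam i)) /= [X in _ = _ + X]big1 ?addn0.
    rewrite -[RHS]big_filter; apply: perm_big; apply: uniq_perm => [||i].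
    - exact: fset_uniq.
    - exact/filter_uniq/iota_uniq.
    - by rewrite mem_calE mem_filter mem_index_iota andbC.
  by move=> i; lia.
have : \sum_(i < t) n_ lam i = \sum_(i < t) ((n_ lam i).-1 + 1).
  by apply: eq_bigr => i _; have := n_ge1 (ltn_ord i); lia.
rewrite sn big_split /= sum1_card card_ord; lia.
Qed.

Lemma size_all_Delta : size all_Delta = 2 * r.
Proof.
rewrite size_flatten /shape sumnE !big_map -sum_calE_pred.
apply: eq_big_seq => i iE /=.
by rewrite DeltaE size_pair_sums (perm_size (class_perm iE)) size_class_of.
Qed.

(** Sums above, equal to and below [tau] are counted by [pos], [tie] and [neg]; the rest expresses
    that [tau] is the [r]-th largest of the $2r$ sums. *)
Lemma tau_counts : 0 < r -> let tau := tau lam in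
  [/\ count (pos t tau B) B < r, r <= count (tie t tau B) B + count (pos t tau B) B &
   count (tie t tau B) B + count (pos t tau B) B + count (neg t tau B) B = 2 * r].
Proof.
move=> r0 tau0; rewrite -count_Delta_gt -count_Delta_lt -count_Delta_eq.
pose s := sort geq all_Delta.
have ps p : count p all_Delta = count p s by rewrite count_sort.
have sz : size s = 2 * r by rewrite size_sort size_all_Delta.
have [] := @sorted_geq_nth_count s r.-1; first by rewrite sz; lia.
  by apply: sort_sorted => x y; apply: leq_total.
rewrite -[nth 0 s r.-1]/tau0 => h1 h2; rewrite !ps; split; first by lia.
  have <- : count (fun x => tau0 <= x) s =
      count (fun x => x == tau0) s + count (fun x => tau0 < x) s.
    elim: s {ps sz h1 h2} => //= x s IH; rewrite IH; case: ltngtP; lia.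
  by lia.
rewrite -sz; elim: s {ps sz h1 h2} => //= x s IH; rewrite -IH; case: ltngtP; lia.
Qed.

End Betas.

(** * Structure forced by the vanishing *)

Lemma vanishing_structure (R : realType) (t r : nat) (lam : 'I_(t + 2 * r) -> nat) :
  (0 < t)%N -> (0 < r)%N ->
  (forall i j : 'I_(t + 2 * r), (i <= j)%N -> (lam j <= lam i)%N) ->
  (forall z : 'I_r -> R[i], (forall a, z a != 0) ->
       (schur R[i] lam).@[spec_point t z] = 0) ->
  (forall i : nat, (i < t)%N -> (1 <= n_ lam i)%N) ->
  let B := betas lam in let tau := tau lam in
  [/\ ~~ odd t, count (tie t tau B) B = 2, count (pos t tau B) B = r.-1,
      count (neg t tau B) B = r.-1 &
      perm_eq [seq c%:Z | c <- B & pos t tau B c]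
              [seq tau%:Z - c%:Z | c <- B & neg t tau B c]].
Proof.
move=> t0 r0 dec van n1 B tau0.
have pe := zeta_prim_root R t0.
have uB : uniq B by apply: uniq_betas.
have K (z : nat -> R[i]) : (forall a, z a != 0) -> exists X, kernel_sys t r tau0 B z X.
  move=> z0; exact: limit_kernel_sys (beta_inj dec) pe (schur_vanish_det van) z0.
have [h1 h2 h3] := tau_counts dec n1 t0 r0.
rewrite -/tau0 -/B in h1 h2 h3.
have [X KX] := K _ (pow2_neq0 _).
have h4 := kernel_count_gt uB KX; have [h5 h6] := ties_le2 tau0 uB t0.
(* Once [neg] is bounded by [r], the kernel gives more than [r] elements in [tie] and [pos]. With
   fewer than [r] in [pos] and at most two ties, all counts are determined. *)
have cn : (count (neg t tau0 B) B <= r)%N by lia.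
have {h4} h4 := h4 cn.
have ct : count (tie t tau0 B) B = 2%N by lia.
have cp : count (pos t tau0 B) B = r.-1 by lia.
have cn' : count (neg t tau0 B) B = r.-1 by lia.
split=> //; first exact: h6.
case E : [seq c <- B | tie t tau0 B c] (ct) => [|a [|b [|c s]]];
  rewrite -size_filter E //= => _.
by apply: (kernel_symmetric uB (n := r.-1) _ K E); rewrite ?prednK.
Qed.

(** * Choices of maximal degree *)

Section Degree.
Variables (r tau : nat).
Implicit Types (T : {fset nat}).

(** $2\deg T$ sums $2c-\tau$ over the upper half and $\tau-2c$ over the lower half. [slack] measures
    how far these terms fall short of $|2c-\tau|$; it is 0 exactly when no upper element is below
    $\tau/2$ and no lower one above. *)
Lemma deg_bound T : #|` T| = (2 * r)%N ->
  deg r T * 2 <= (\sum_(c <- T) dist tau c)%:Z /\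
  (deg r T * 2 = (\sum_(c <- T) dist tau c)%:Z <->
   (count (fun c => tau < 2 * c) T <= r)%N /\ (count (fun c => 2 * c < tau) T <= r)%N).
Proof.
move=> sT; set s := dec_seq T.
have ss : size s = (2 * r)%N by rewrite size_sort.
have perm_s : perm_eq s T by rewrite perm_sort.
have s_sorted : sorted gtn s by apply: dec_seq_sorted.
have mono i j : (i < j)%N -> (j < size s)%N -> (nth 0 s j < nth 0 s i)%N.
  move=> ij lj; apply: (@sorted_ltn_nth _ gtn _ 0%N s s_sorted) => //.
    by move=> u v w /= uv vw; apply: ltn_trans vw uv.
  exact: ltn_trans ij lj.
rewrite -!(seq.permP perm_s) -(perm_big _ perm_s) /=.
rewrite (big_nth 0%N) ss (big_cat_nat (n := r)) //=; last by lia.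
set slack := (\sum_(0 <= a < r) 2 * (tau - 2 * nth 0 s a) +
              \sum_(r <= a < 2 * r) 2 * (2 * nth 0 s a - tau))%N.
have slackE : (\sum_(0 <= a < r) dist tau (nth 0 s a) +
    \sum_(r <= a < 2 * r) dist tau (nth 0 s a))%N%:Z = deg r T * 2 + slack%:Z.
  have sumZ m n (f : nat -> nat) : (\sum_(m <= a < n) f a)%N%:Z = \sum_(m <= a < n) (f a)%:Z.
    exact: (big_morph Posz PoszD (erefl 0%:Z)).
  have -> : deg r T * 2 = \sum_(0 <= a < r) (2 * (nth 0%N s a)%:Z - tau%:Z) +
      \sum_(r <= a < 2 * r) (tau%:Z - 2 * (nth 0%N s a)%:Z).
    rewrite /deg -/s !sumrB -!mulr_sumr !sumr_const_nat.
    have -> : (2 * r - r = r - 0)%N by lia.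
    ring.
  rewrite !PoszD !sumZ addrACA -!big_split /=; congr (_ + _); apply: eq_bigr => a _;
    rewrite /dist; lia.
rewrite slackE; split; first by rewrite lerDl.
have -> : deg r T * 2 = deg r T * 2 + slack%:Z <-> slack = 0%N by lia.
have cat_count p : count p s = (count p (take r s) + count p (drop r s))%N.
  by rewrite -count_cat cat_take_drop.
have st : size (take r s) = r by rewrite size_take ss; case: ifP; lia.
have sd : size (drop r s) = r by rewrite size_drop ss; lia.
split.
  move/eqP; rewrite addn_eq0 !sum_nat_seq_eq0 => /andP[/allP ht /allP hd].
  rewrite !cat_count; split.
    rewrite [X in (_ + X)%N](_ : _ = 0%N) ?addn0; last first.
      apply/eqP; rewrite -leqn0 leqNgt -has_count; apply/hasPn => y /(nthP 0%N)[k].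
      rewrite sd => lk <-; rewrite nth_drop.
      have lk' : (r + k)%N \in index_iota r (2 * r) by rewrite mem_index_iota; lia.
      by have := hd _ lk'; rewrite /= muln_eq0 subn_eq0 -leqNgt.
    by rewrite -[X in (_ <= X)%N]st count_size.
  rewrite [X in (X + _)%N](_ : _ = 0%N) ?add0n; last first.
    apply/eqP; rewrite -leqn0 leqNgt -has_count; apply/hasPn => y /(nthP 0%N)[k].
    rewrite st => lk <-; rewrite nth_take //.
    have lk' : k \in index_iota 0 r by rewrite mem_index_iota.
    by have := ht _ lk'; rewrite /= muln_eq0 subn_eq0 -leqNgt.
  by rewrite -[X in (_ <= X)%N]sd count_size.
case=> [hp hn]; apply/eqP; rewrite addn_eq0 !sum_nat_seq_eq0; apply/andP; split.
  apply/allP => a; rewrite mem_index_iota => /= la; rewrite muln_eq0 subn_eq0 /=.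
  rewrite leqNgt; apply/negP => lt.
  (* If the entry at [a < r] is below $\tau/2$, so are all later ones, which makes more than [r] of
     them. *)
  have := count_size (fun c => 2 * c < tau)%N (drop a s).
  have : all (fun c => 2 * c < tau)%N (drop a s).
    apply/(all_nthP 0%N) => k; rewrite size_drop ss nth_drop => lk.
    case: k lk => [|k] lk; first by rewrite addn0.
    by have := mono a (a + k.+1)%N; rewrite ss; lia.
  rewrite all_count size_drop ss => /eqP e _.
  have : (count (fun c => 2 * c < tau)%N s = count (fun c => 2 * c < tau)%N (take a s) +
     count (fun c => 2 * c < tau)%N (drop a s))%N by rewrite -count_cat cat_take_drop.
  by lia.
apply/allP => a; rewrite mem_index_iota => /= la; rewrite muln_eq0 subn_eq0 /=.
rewrite leqNgt; apply/negP => lt.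
have : all (fun c => tau < 2 * c)%N (take a.+1 s).
  apply/(all_nthP 0%N) => k; rewrite size_take ss => lk.
  have {lk} : (k < a.+1)%N by move: lk; case: ifP; lia.
  rewrite ltnS leq_eqVlt => /orP[/eqP->|lk]; rewrite nth_take //; last by lia.
  by have := mono k a; rewrite ss; lia.
rewrite all_count size_take ss => /eqP e.
have : (count (fun c => tau < 2 * c)%N s = count (fun c => tau < 2 * c)%N (take a.+1 s) +
   count (fun c => tau < 2 * c)%N (drop a.+1 s))%N by rewrite -count_cat cat_take_drop.
by move: e; case: ifP; lia.
Qed.
End Degree.

Section Choices.
Local Open Scope fset_scope.
Variables (t r : nat) (lam : 'I_(t + 2 * r) -> nat) (tau : nat).
Local Open Scope nat_scope.
Hypothesis lam_dec : forall i j : 'I_(t + 2 * r), i <= j -> lam j <= lam i.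
Hypothesis n_ge1 : forall i : nat, i < t -> 1 <= n_ lam i.
Hypothesis t0 : 0 < t.
Hypothesis r0 : 0 < r.
Local Notation B := (betas lam).
Local Notation E := (calE lam).
Local Notation S := (calS lam).
Local Notation pos := (pos t tau B).
Local Notation neg := (neg t tau B).
Local Notation tie := (tie t tau B).
Local Notation low := (low t tau B).
Local Notation neutral := (neutral t tau B).
Local Notation md := (min_dist t tau B).

Lemma choiceP g : is_choice lam g -> g `<=` S /\ perm_eq [seq x %% t | x <- g] E.
Proof.
case/andP=> gS /allP one; split=> //.
have gE x : x \in g -> x %% t \in E.
  by move/(fsubsetP gS); rewrite mem_calS => /andP[].
apply: uniq_perm; rewrite ?fset_uniq //.
  rewrite map_inj_in_uniq ?fset_uniq // => x y xg yg e.
  have /cardfs1P[w ew] := one _ (gE x xg).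
  have : x \in res_class t g (x %% t) by rewrite mem_res_class xg eqxx.
  have : y \in res_class t g (x %% t) by rewrite mem_res_class yg e eqxx.
  by rewrite ew !inE => /eqP-> /eqP->.
move=> i; apply/mapP/idP => [[x xg ->]|iE]; first exact: gE.
have /cardfs1P[w ew] := one _ iE.
have : w \in res_class t g i by rewrite ew inE eqxx.
by rewrite mem_res_class => /andP[wg /eqP <-]; exists w.
Qed.

Lemma card_calS : #|` S| = 2 * r + size E.
Proof.
have sS : #|` S| = count (fun x => x %% t \in E) B.
  rewrite -size_filter; apply/perm_size/uniq_perm.
  - exact: fset_uniq.
  - exact/filter_uniq/uniq_betas.
  by move=> x; rewrite mem_filter mem_calS andbC.
rewrite sS -(@sum_count_classes _ _ lam) // -(sum_calE_pred n_ge1 t0) -sum1_size -big_split.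
apply: eq_big_seq => i iE /=.
have -> : count (fun x => x %% t \in E) (class_of t B i) = n_ lam i.
  rewrite -size_class_of; apply/eqP; rewrite -all_count; apply/allP => x.
  by rewrite mem_filter => /andP[/eqP->].
have : i < t by move: iE; rewrite mem_calE => /andP[].
by move/n_ge1; lia.
Qed.

Lemma card_choice_compl g : is_choice lam g -> #|` S `\` g| = 2 * r.
Proof.
case/choiceP => gS /perm_size; rewrite size_map => sg.
by rewrite cardfsDS // card_calS -sg addnK.
Qed.

Lemma sum_dist_compl g : g `<=` S ->
  \sum_(c <- S) dist tau c = \sum_(c <- g) dist tau c + \sum_(c <- S `\` g) dist tau c.
Proof.
move=> gS; rewrite -big_cat /=; apply: perm_big; apply: uniq_perm.
- exact: fset_uniq.
- rewrite cat_uniq !fset_uniq /= andbT; apply/hasPn => x.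
  by rewrite in_fsetD => /andP[].
move=> x; rewrite mem_cat in_fsetD; case: (boolP (x \in g)) => //= xg.
by rewrite (fsubsetP gS).
Qed.

(** A choice has one element per class, at no less than the minimal distance, and at that distance
    exactly when neutral. *)
Lemma choice_dist g : is_choice lam g ->
  \sum_(i <- E) md i <= \sum_(c <- g) dist tau c /\
  (\sum_(i <- E) md i = \sum_(c <- g) dist tau c <-> {in g, forall x, neutral x}).
Proof.
move=> cg; have [gS pE] := choiceP cg.
have gB x : x \in g -> x \in B.
  by move/(fsubsetP gS); rewrite mem_calS => /andP[].
rewrite -(perm_big _ pE) big_map.
have -> : \sum_(c <- g) dist tau c =
    \sum_(c <- g) md (c %% t) + \sum_(c <- g) (dist tau c - md (c %% t)).
  by rewrite -big_split /=; apply: eq_big_seq => x xg; rewrite subnKC // min_dist_le ?gB.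
split; first exact: leq_addr.
split=> [e x xg|H].
  have /eqP : \sum_(c <- g) (dist tau c - md (c %% t)) = 0.
    by apply: (@addnI (\sum_(c <- g) md (c %% t))); rewrite addn0 -e.
  rewrite sum_nat_seq_eq0 => /allP/(_ x xg) /=; rewrite subn_eq0 => le.
  by rewrite -min_dist_neutral ?gB // eqn_leq le min_dist_le ?gB.
rewrite [X in _ = _ + X]big1_seq ?addn0 // => x /= xg.
by have := H x xg; rewrite -min_dist_neutral ?gB // => /eqP->; rewrite subnn.
Qed.

Definition tie_pair u v := [/\ u \in B, v \in B, u != v &
  forall c, c \in B -> tie c = (c == u) || (c == v)].

(** The neutral choice that takes [tau - u] in the class of the tie [u] and [v] in that of the tie
    [v]. *)
Definition tie_choice u v : {fset nat} :=
  [fset x in S | [&& neutral x, x != u & x != tau - v]].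

Lemma mem_tie_choice u v x : (x \in tie_choice u v) =
  [&& x \in S, neutral x, x != u & x != tau - v].
Proof. by rewrite !inE. Qed.

Lemma tie_choiceP u v : tie_pair u v -> is_choice lam (tie_choice u v).
Proof.
case=> uB vB nuv tE; have tu : tie u by rewrite tE ?eqxx.
have tv : tie v by rewrite tE ?eqxx ?orbT.
have /tieP[_ leu duB eu ltu] := tu; have /tieP[_ lev dvB ev ltv] := tv.
apply/andP; split; first by apply/fsubsetP => x; rewrite mem_tie_choice => /and4P[].
apply/allP => i iE; apply/cardfs1P.
(* Take an element closest to $\tau/2$; if it is one of the two excluded ones, take the other member
   of its pair. *)
have [x [xg xi]] : exists x, x \in tie_choice u v /\ x %% t = i.
  have [c ci] : exists c, c \in class_of t B i.
    have := iE; rewrite mem_calE -size_class_of => /andP[_].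
    by case: (class_of t B i) => // c s _; exists c; rewrite mem_head.
  have [/mapP[m mc mE] _] := min_distP tau ci.
  move: mc; rewrite mem_filter => /andP[/eqP mi mB].
  have nm : neutral m by rewrite -min_dist_neutral // mi mE.
  have inS x : x \in B -> x %% t = i -> x \in S by rewrite mem_calS => -> ->; rewrite iE.
  have [mu|nmu] := eqVneq m u.
    have ui : (tau - u) %% t = i by rewrite eu -mu.
    exists (tau - u); split=> //; rewrite mem_tie_choice inS //=.
    rewrite (low_neutral (tie_low uB tu)) (ltn_eqF ltu) /=.
    by apply: contra nuv => /eqP Euv; apply/eqP; clear -Euv leu lev; lia.
  have [mv|nmv] := eqVneq m (tau - v).
    have vi : v %% t = i by rewrite -ev -mv.
    exists v; split=> //; rewrite mem_tie_choice inS //= (tie_neutral tv).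
    by rewrite eq_sym nuv gtn_eqF.
  by exists m; rewrite mem_tie_choice inS ?nm ?nmu.
exists x; apply/fsetP => y; rewrite mem_res_class inE.
apply/andP/eqP => [[yg /eqP yi]|->]; last by rewrite xi eqxx.
move: xg yg; rewrite !mem_tie_choice => /and4P[xS nx xu xv] /and4P[yS ny yu yv].
have [xB yB] : x \in B /\ y \in B by move: xS yS; rewrite !mem_calS => /andP[-> _] /andP[-> _].
have e : y %% t = x %% t by rewrite xi.
have [//|[s /orP[tx|lx] /orP[ty|ly]]] := neutral_class xB yB nx ny e.
- by have := tie_gt tx; have := tie_gt ty; clear -s; lia.
- move: tx; rewrite tE // (negPf xu) /= => /eqP xv'.
  by case/eqP: yv; clear -s xv'; lia.
- move: ty; rewrite tE // (negPf yu) /= => /eqP yv'.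
  by case/eqP: xv; clear -s yv'; lia.
- by have := low_lt lx; have := low_lt ly; clear -s; lia.
Qed.

Hypothesis count_pos : count pos B = r.-1.
Hypothesis count_neg : count neg B = r.-1.

(** The complement consists of [pos], [neg], [u] and [tau - v], hence is balanced around
    $\tau/2$. *)
Lemma tie_choice_deg u v : tie_pair u v ->
  (deg r (S `\` tie_choice u v) * 2)%R = (\sum_(c <- S `\` tie_choice u v) dist tau c)%N%:Z.
Proof.
move=> tp; have [_ ->] := deg_bound tau (card_choice_compl (tie_choiceP tp)).
have [uB vB nuv tE] := tp; have tu : tie u by rewrite tE ?eqxx.
have tv : tie v by rewrite tE ?eqxx ?orbT.
have out x : x \in S `\` tie_choice u v -> x \in B /\ [|| pos x, neg x, x == u | x == tau - v].
  rewrite in_fsetD mem_tie_choice => /andP[]; rewrite mem_calS => /nandP[/negP//|].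
  by move=> h /andP[xB _]; split=> //; move: h; rewrite /neutral !negb_and !negbK -!orbA.
have bound (p : pred nat) s : size s <= r ->
    (forall x, x \in S `\` tie_choice u v -> p x -> x \in s) ->
    count p (S `\` tie_choice u v) <= r.
  move=> ls H; rewrite -size_filter; apply: leq_trans ls; apply: uniq_leq_size.
    exact/filter_uniq/fset_uniq.
  by move=> x; rewrite mem_filter => /andP[px xS]; apply: H.
split.
  apply: (bound _ (u :: [seq c <- B | pos c])).
    by rewrite /= size_filter count_pos prednK.
  move=> x /out[xB]; rewrite inE mem_filter xB andbT.
  case/or4P=> [->|/neg_lt|->|/eqP->] //; rewrite ?orbT //; first by clear; lia.
  by have := low_lt (tie_low vB tv); clear; lia.
apply: (bound _ (tau - v :: [seq c <- B | neg c])).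
  by rewrite /= size_filter count_neg prednK.
move=> x /out[xB]; rewrite inE mem_filter xB andbT.
case/or4P=> [/pos_gt|->|/eqP->|->] //; rewrite ?orbT //; first by clear; lia.
by have := tie_gt tu; clear; lia.
Qed.

(** Twice the degree is at most the total distance of $\mathcal{S}$ minus that of the choice, itself
    at least the sum of class minima. [tie_choice] attains both bounds, so another maximizer must as
    well. *)
Lemma choice_deg_le u v h : tie_pair u v -> is_choice lam h ->
  (deg r (S `\` h) <= deg r (S `\` tie_choice u v))%R /\
  ((deg r (S `\` h) >= deg r (S `\` tie_choice u v))%R ->
   {in h, forall x, neutral x} /\
   count (fun c => tau < 2 * c) (S `\` h) <= r /\
   count (fun c => 2 * c < tau) (S `\` h) <= r).
Proof.
move=> tp ch; have cg := tie_choiceP tp.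
have dg := tie_choice_deg tp.
have [dh1 dh2] := deg_bound tau (card_choice_compl ch).
have sg := sum_dist_compl (proj1 (choiceP cg)); have sh := sum_dist_compl (proj1 (choiceP ch)).
have [g1 [_ g2]] := choice_dist cg; have [h1 [h2 _]] := choice_dist ch.
have {}g2 : \sum_(i <- E) md i = \sum_(c <- tie_choice u v) dist tau c.
  by apply: g2 => x; rewrite mem_tie_choice => /and4P[].
move: dg dh1 dh2 sg sh g1 g2 h1 h2.
move: (\sum_(c <- S) _) (\sum_(c <- tie_choice u v) _) (\sum_(i <- E) _) (\sum_(c <- h) _).
move: (\sum_(c <- S `\` h) _) (\sum_(c <- S `\` tie_choice u v) _) (deg r _) (deg r _).
move=> sSh sSg dh dg sS sg sE sh e1 e2 e3 e4 e5 _ e7 e8 e9.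
split; first by clear -e1 e2 e4 e5 e7 e8; lia.
move=> le; split; first by apply: e9; clear -le e1 e2 e4 e5 e7 e8; lia.
by apply/e3; clear -le e1 e2 e4 e5 e7 e8; lia.
Qed.

End Choices.

(** * The two maximizing choices and their intersection *)

Section Maximisers.
Local Open Scope fset_scope.
Variables (t r : nat) (lam : 'I_(t + 2 * r) -> nat) (tau : nat).
Local Open Scope nat_scope.
Hypothesis lam_dec : forall i j : 'I_(t + 2 * r), i <= j -> lam j <= lam i.
Hypothesis n_ge1 : forall i : nat, i < t -> 1 <= n_ lam i.
Hypothesis t0 : 0 < t.
Hypothesis r0 : 0 < r.
Local Notation B := (betas lam).
Local Notation E := (calE lam).
Local Notation S := (calS lam).
Local Notation pos := (pos t tau B).
Local Notation neg := (neg t tau B).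
Local Notation tie := (tie t tau B).
Local Notation low := (low t tau B).
Local Notation neutral := (neutral t tau B).
Hypothesis count_pos : count pos B = r.-1.
Hypothesis count_neg : count neg B = r.-1.
Variables a b : nat.
Hypothesis tp : tie_pair lam tau a b.
Local Notation choice := (tie_choice lam tau).

Lemma tie_pair_sym u v : tie_pair lam tau u v -> tie_pair lam tau v u.
Proof.
case=> uB vB nuv tE; split=> //; first by rewrite eq_sym.
by move=> c cB; rewrite tE // orbC.
Qed.

Lemma tie_pair_facts u v : tie_pair lam tau u v -> [/\ u \in S, tau - u \in S, neutral u,
  neutral (tau - u) & [/\ u <= tau, tau < 2 * u, (tau - u) %% t = u %% t & tie u]].
Proof.
case=> uB vB nuv tE; have tu : tie u by rewrite tE ?eqxx.
have /tieP[_ le dB e lt] := tu.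
split.
- apply/calSP => //; split=> //; exists (tau - u); rewrite // e; split=> //.
  by rewrite ltn_eqF.
- apply/calSP => //; split=> //; exists u; rewrite // e; split=> //.
  by rewrite gtn_eqF.
- exact: tie_neutral.
- exact/low_neutral/tie_low.
by split=> //; apply: tie_gt tu.
Qed.

Lemma choice_same_class g x y : is_choice lam g -> x \in g -> y \in g -> x %% t = y %% t -> x = y.
Proof.
move=> cg xg yg e; have [gS _] := choiceP cg.
case/andP: cg => _ /allP one.
have xE : x %% t \in E by move: (fsubsetP gS _ xg); rewrite mem_calS => /andP[].
have /cardfs1P[w ew] := one _ xE.
have : x \in res_class t g (x %% t) by rewrite mem_res_class xg eqxx.
have : y \in res_class t g (x %% t) by rewrite mem_res_class yg e eqxx.
by rewrite ew !inE => /eqP-> /eqP->.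
Qed.

Lemma choice_meets g x : is_choice lam g -> x \in S -> exists2 y, y \in g & y %% t = x %% t.
Proof.
move=> cg; have [_ pE] := choiceP cg; rewrite mem_calS => /andP[_].
by rewrite -(perm_mem pE) => /mapP[y yg ->]; exists y.
Qed.

Lemma tie_choice_of u v g : tie_pair lam tau u v -> is_choice lam g ->
  {in g, forall x, neutral x} -> u \notin g -> tau - v \notin g -> g = choice u v.
Proof.
move=> tuv cg ng ug vg; have [gS pg] := choiceP cg.
have [_ pc] := choiceP (tie_choiceP tuv).
apply/eqP; rewrite eqEfcard; apply/andP; split.
  apply/fsubsetP => x xg; rewrite mem_tie_choice (fsubsetP gS) // ng //=.
  by apply/andP; split; [apply: contraNneq ug | apply: contraNneq vg] => <-.
have := perm_size pc; rewrite -(perm_size pg) !size_map => e.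
by rewrite leq_eqVlt e eqxx.
Qed.

Lemma non_neutral_calS x : x \in B -> ~~ neutral x -> x \in S.
Proof.
move=> xB; rewrite negb_and !negbK => /orP[/posP|/negSP] [d [dB e lt _]];
  apply/calSP => //; split=> //; exists d => //; split=> //.
  by rewrite ltn_eqF.
by rewrite gtn_eqF.
Qed.

(** A maximizer is neutral, so it contains exactly one member of each tied pair. Containing both [a]
    and [b] would leave $r+1$ elements below $\tau/2$ in the complement; containing neither would
    leave $r+1$ above. *)
Lemma calG_pair : calG lam = [fset choice a b; choice b a].
Proof.
have tq := tie_pair_sym tp.
have best u v : tie_pair lam tau u v -> choice u v \in calG lam.
  move=> tuv; have cg := tie_choiceP tuv; have [gS _] := choiceP cg.
  rewrite !inE /= fpowersetE gS cg /=; apply/allP => h _; apply/implyP => ch.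
  by have [] := choice_deg_le lam_dec n_ge1 t0 r0 count_pos count_neg tuv ch.
apply/fsetP => g; rewrite in_fset2; apply/idP/orP => [|[]/eqP->]; last 2 first.
- exact: best.
- exact: best.
rewrite !inE /= => /and3P[_ cg /allP gmax].
have [_] := choice_deg_le lam_dec n_ge1 t0 r0 count_pos count_neg tp cg.
have cab := tie_choiceP tp.
have : choice a b \in fpowerset S by rewrite fpowersetE; case: (choiceP cab).
move=> /gmax/implyP/(_ cab) le /(_ le) [ng [np nn]].
have [aS aS' na na' [lea gea ea ta]] := tie_pair_facts tp.
have [bS bS' nb nb' [leb geb eb tb]] := tie_pair_facts tq.
have [aB bB nab tE] := tp.
have nle (p q : pred nat) s : count p B = r.-1 -> uniq s -> size s = 2 ->
    (forall x, x \in B -> p x -> x \in S `\` g /\ q x /\ x \notin s) ->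
    (forall x, x \in s -> x \in S `\` g /\ q x) -> r < count q (S `\` g).
  move=> cp us ss H1 H2.
  have -> : r.+1 = size (s ++ [seq x <- B | p x]).
    by rewrite size_cat ss size_filter cp; case: r r0.
  rewrite -size_filter; apply: uniq_leq_size.
    rewrite cat_uniq us filter_uniq ?uniq_betas // andbT.
    by apply/hasPn => x; rewrite mem_filter => /andP[px xB]; have [_ []] := H1 x xB px.
  move=> x; rewrite mem_cat mem_filter => /orP[/H2[xT qx]|]; first by rewrite mem_filter qx.
  by rewrite mem_filter => /andP[px xB]; have [xT [qx _]] := H1 x xB px; rewrite qx.
have nnS x : x \in B -> ~~ neutral x -> x \in S `\` g.
  move=> xB nx; rewrite in_fsetD non_neutral_calS // andbT.
  by apply: contra nx; apply: ng.
have other u v : tie_pair lam tau u v -> u \notin g -> tau - u \in g.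
  move=> tuv ug; have [uS _ _ _ [leu gu eu tu]] := tie_pair_facts tuv.
  have [uB _ _ _] := tuv.
  have [y yg ey] := choice_meets cg uS.
  have yB : y \in B.
    by have [/fsubsetP gS _] := choiceP cg; have := gS y yg; rewrite mem_calS => /andP[].
  have [yu|[s _ _]] := neutral_class uB yB (tie_neutral tu) (ng y yg) ey.
    by rewrite yu (negPf ug) in yg.
  by have -> : tau - u = y by clear -s; lia.
have excl u v : tie_pair lam tau u v -> u \in g -> tau - u \notin g.
  move=> tuv ug; have [_ _ _ _ [leu gu eu _]] := tie_pair_facts tuv.
  apply/negP => ug'; have := choice_same_class cg ug' ug eu.
  by clear -leu gu; lia.
case: (boolP (a \in g)) => ag; case: (boolP (b \in g)) => bg.
- suff: r < count (fun c => 2 * c < tau) (S `\` g) by rewrite ltnNge nn.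
  apply: (nle neg _ [:: tau - a; tau - b] count_neg) => //.
  + by rewrite /= inE andbT; apply: contra nab => /eqP e; apply/eqP; clear -e lea leb; lia.
  + move=> x xB nx; split; first by apply: nnS; rewrite // negb_and !negbK nx orbT.
    split; first exact: neg_lt nx.
    rewrite !inE; apply/norP; split; apply/eqP => xE; move: nx; rewrite xE; apply/negP.
      by case/andP: na'.
    by case/andP: nb'.
  move=> x; rewrite mem_seq2 => /orP[]/eqP->; rewrite in_fsetD ?aS' ?bS' andbT.
    by rewrite (excl _ _ tp ag); split=> //; clear -lea gea; lia.
  by rewrite (excl _ _ tq bg); split=> //; clear -leb geb; lia.
- right; apply/eqP; apply: tie_choice_of => //.
  exact: excl tp ag.
- left; apply/eqP; apply: tie_choice_of => //.
  exact: excl tq bg.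
suff: r < count (fun c => tau < 2 * c) (S `\` g) by rewrite ltnNge np.
apply: (nle pos _ [:: a; b] count_pos) => //.
- by rewrite /= inE andbT.
- move=> x xB px; split; first by apply: nnS; rewrite // negb_and !negbK px.
  split; first exact: pos_gt px.
  rewrite !inE; apply/norP; split; apply/eqP => xE; move: px; rewrite xE; apply/negP.
    by case/andP: na.
  by case/andP: nb.
by move=> x; rewrite mem_seq2 => /orP[]/eqP->; rewrite in_fsetD ?aS ?bS andbT.
Qed.

(** The two maximizers take opposite members of both tied pairs and agree on all other neutral
    elements. *)
Lemma mem_calS_diff_gcom x : (x \in S `\` g_com lam) =
  (x \in S) && (~~ neutral x || (x \in [:: a; b; tau - a; tau - b])).
Proof.
rewrite in_fsetD /g_com calG_pair; case: (boolP (x \in S)) => xS; last by rewrite andbF.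
have -> : (x \in [fset x in S | all (fun g : {fset nat} => x \in g)
    [fset choice a b; choice b a]]) = (x \in choice a b) && (x \in choice b a).
  have -> : forall p : pred nat, (x \in [fset x in S | p x]) = (x \in S) && p x.
    by move=> p; rewrite !inE.
  rewrite xS; apply/allP/andP => [H|[h1 h2] g].
    by split; apply: H; rewrite in_fset2 eqxx ?orbT.
  by rewrite in_fset2 => /orP[]/eqP->.
rewrite !mem_tie_choice xS andbT !inE; case: neutral => //=.
by rewrite -negb_or; case: (x == a); case: (x == b); case: (x == tau - a); case: (x == tau - b).
Qed.

End Maximisers.

(** * Extreme elements and conclusion *)

Local Open Scope fset_scope.

Lemma fset_maxP (A : {fset nat}) x : x \in A ->
  fset_max A \in A /\ forall y, y \in A -> (y <= fset_max A)%N.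
Proof.
move=> xA; rewrite /fset_max; have := dec_seq_sorted A.
have mE y : (y \in dec_seq A) = (y \in A) by rewrite mem_sort.
case E : (dec_seq A) => [|m s]; first by rewrite -mE E in xA.
move=> srt; split; first by rewrite -mE E mem_head.
move=> y; rewrite -mE E inE => /orP[/eqP->//|ys].
have tr : transitive gtn by move=> u v w /= uv vw; apply: ltn_trans vw uv.
exact/ltnW/(allP (order_path_min tr srt)).
Qed.

Lemma fset_minP (A : {fset nat}) x : x \in A ->
  fset_min A \in A /\ forall y, y \in A -> (fset_min A <= y)%N.
Proof.
move=> xA; rewrite /fset_min; have := dec_seq_sorted A.
have mE y : (y \in dec_seq A) = (y \in A) by rewrite mem_sort.
case/lastP E : (dec_seq A) => [|s m]; first by rewrite -mE E in xA.
rewrite last_rcons => srt; split; first by rewrite -mE E mem_rcons mem_head.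
move=> y; rewrite -mE E mem_rcons inE => /orP[/eqP->//|ys].
have := srt; rewrite -[rcons s m]revK rev_sorted rev_rcons /= => srt'.
have tr : transitive (fun y x => gtn x y) by move=> u v w /= uv vw; apply: ltn_trans uv vw.
by apply/ltnW/(allP (order_path_min tr srt')); rewrite mem_rev.
Qed.

Theorem corollary8p34 (R : realType) (t r : nat) (ht : (2 <= t)%N)
    (hr : (1 <= r)%N) (lam : 'I_(t + 2 * r) -> nat)
    (hlam : forall i j : 'I_(t + 2 * r), (i <= j)%N -> (lam j <= lam i)%N)
    (hvanish : forall z : 'I_r -> R[i], (forall a, z a != 0) ->
       (schur R[i] lam).@[spec_point t z] = 0)
    (hres : forall i : nat, (i < t)%N -> (1 <= n_ lam i)%N) :
  [/\ ~~ odd t,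
      #|` calG lam| = 2%N,
      (fset_min (calS lam) + fset_max (calS lam))%N = tau lam &
      forall x : nat, x \in calS lam `\` g_com lam ->
        (x <= tau lam)%N /\ (tau lam - x)%N \in calS lam `\` g_com lam].
Proof.
have t0 : (0 < t)%N by apply: leq_trans ht.
have [t_even ct cp cn PQ] := vanishing_structure t0 hr hlam hvanish hres.
set B := betas lam in ct cp cn PQ; move: (tau lam) ct cp cn PQ => tau ct cp cn PQ.
have uB : uniq B by apply: uniq_betas.
have [a [b tp]] : exists a b, tie_pair lam tau a b.
  case E : [seq c <- B | tie t tau B c] (ct) => [|a [|b [|c s]]]; rewrite -size_filter E //= => _.
  have inE' c : (c \in [:: a; b]) = tie t tau B c && (c \in B) by rewrite -E mem_filter.
  have := filter_uniq (tie t tau B) uB; rewrite E /= inE andbT => nab.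
  have /andP[_ aB] : tie t tau B a && (a \in B) by rewrite -inE' mem_head.
  have /andP[_ bB] : tie t tau B b && (b \in B) by rewrite -inE' !inE eqxx orbT.
  exists a, b; split=> //.
  by move=> c cB; have := inE' c; rewrite !inE cB andbT => <-.
have tq := tie_pair_sym tp.
have WE := mem_calS_diff_gcom hlam hres t0 hr cp cn tp.
have [aS aS' na na' [lea gea ea ta]] := tie_pair_facts hlam t0 tp.
have [bS bS' nb nb' [leb geb eb tb]] := tie_pair_facts hlam t0 tq.
set S := calS lam in aS aS' bS bS' WE *; set W := S `\` g_com lam in WE *.
have nonneutW x : x \in B -> ~~ neutral t tau B x -> x \in W.
  by move=> xB nx; rewrite WE nx orTb andbT; apply: (non_neutral_calS hlam t0 xB nx).
(* Reflection exchanges the members of each tied pair, and [pos] with [neg] by [PQ]. *)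
have symW x : x \in W -> (x <= tau)%N /\ (tau - x)%N \in W.
  rewrite WE => /andP[xS /orP[nx|]]; last first.
    rewrite 3!in_cons mem_seq1 => /or4P[]/eqP->;
      by rewrite ?leq_subr ?lea ?leb WE ?subKn // ?aS ?aS' ?bS ?bS' 3!in_cons mem_seq1 eqxx ?orbT.
  have xB : x \in B by move: xS; rewrite mem_calS => /andP[].
  move: nx; rewrite negb_and !negbK => /orP[px|qx].
    have : x%:Z \in [seq c%:Z | c <- B & pos t tau B c].
      by apply: map_f; rewrite mem_filter px.
    rewrite (perm_mem PQ) => /mapP[q]; rewrite mem_filter => /andP[qn qB] e.
    have ltq := neg_lt qn; have -> : (tau - x)%N = q by clear -e ltq; lia.
    split; first by clear -e ltq; lia.
    by apply: nonneutW; rewrite // negb_and !negbK qn orbT.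
  have : tau%:Z - x%:Z \in [seq tau%:Z - c%:Z | c <- B & neg t tau B c].
    by apply: map_f; rewrite mem_filter qx.
  rewrite -(perm_mem PQ) => /mapP[p]; rewrite mem_filter => /andP[pp pB] e.
  have ltx := neg_lt qx; have -> : (tau - x)%N = p by clear -e ltx; lia.
  split; first by clear -ltx; lia.
  by apply: nonneutW; rewrite // negb_and !negbK pp.
have WS x : x \in W -> x \in S by rewrite WE => /andP[].
(* Elements of [S] outside [W] are lone neutral ones. A congruent [d < x] then satisfies $x+d<\tau$,
   so [d] and [tau - d] lie in [W] on either side of [x]; the case [d > x] mirrors this. Hence [S]
   and [W] have the same extremes. *)
have bracket x : x \in S ->
    (exists2 w, w \in W & (x <= w)%N) /\ (exists2 w, w \in W & (w <= x)%N).
  move=> xS; have [xW|] := boolP (x \in W); first by split; exists x.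
  rewrite WE xS /= negb_or negbK => /andP[nx nab].
  have /(calSP hlam t0) [xB [d dB [ndx e]]] := xS.
  have [/posP np /negSP nn] : ~~ pos t tau B x /\ ~~ neg t tau B x by apply/andP.
  have /norP[nt nl] : ~~ (tie t tau B x || low t tau B x).
    case: tp => _ _ _ tE; apply: contra nab => /orP[tx|lx]; rewrite !inE.
      by move: tx; rewrite tE // => /orP[]->; rewrite ?orbT.
    have /lowP[_ lx' tB _ _] := lx; move: (low_tie xB lx); rewrite tE //.
    by case/orP=> /eqP <-; rewrite subKn // eqxx ?orbT.
  have posW c : c \in B -> pos t tau B c -> c \in W /\ (tau - c)%N \in W.
    move=> cB pc; have cW : c \in W by apply: nonneutW; rewrite // negb_and !negbK pc.
    by have [] := symW c cW.
  have negW c : c \in B -> neg t tau B c -> c \in W /\ (tau - c)%N \in W.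
    move=> cB pc; have cW : c \in W.
      by apply: nonneutW; rewrite // negb_and !negbK pc orbT.
    by have [] := symW c cW.
  have [lt|gt|ed] := ltngtP d x; last by rewrite ed eqxx in ndx.
    have lt_sum : (x + d < tau)%N.
      rewrite ltnNge leq_eqVlt; apply/negP => /orP[/eqP s|s].
        have sd : (tau - x)%N = d by clear -s; lia.
        by case/tieP: nt; rewrite sd; split=> //; [apply/posP | rewrite s leq_addr].
      by apply: np; exists d.
    have nd : neg t tau B d by apply/negSP; exists x; rewrite addnC.
    have [dW tW] := negW d dB nd.
    split; last by exists d; [exact: dW | exact: ltnW].
    by exists (tau - d)%N; [exact: tW | clear -lt_sum; lia].
  have lt_sum : (tau < x + d)%N.
    rewrite ltnNge leq_eqVlt; apply/negP => /orP[/eqP s|s].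
      have sd : (tau - x)%N = d by clear -s; lia.
      by case/lowP: nl; rewrite sd; split=> //; [apply/negSP | rewrite -s leq_addr].
    by apply: nn; exists d.
  have pd : pos t tau B d by apply/posP; exists x; rewrite addnC.
  have [dW tW] := posW d dB pd.
  split; first by exists d; [exact: dW | exact: ltnW].
  by exists (tau - d)%N; [exact: tW | clear -lt_sum; lia].
split=> //.
- rewrite (calG_pair hlam hres t0 hr cp cn tp) cardfs2.
  suff -> : tie_choice lam tau a b != tie_choice lam tau b a by [].
  (* The tie [b] lies in the first choice only. *)
  apply/eqP => /fsetP/(_ b); rewrite !mem_tie_choice eqxx /= !andbF.
  case: tp => _ _ nab _; rewrite bS nb eq_sym nab /= => /negbT/negP[].
  by rewrite gtn_eqF //; clear -leb geb; lia.
have [MS Mge] := fset_maxP aS; have [mS mle] := fset_minP aS.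
have [[w wW Mw] _] := bracket _ MS; have [_ [v vW vm]] := bracket _ mS.
have eM : fset_max S = w by apply/eqP; rewrite eqn_leq Mw Mge ?WS.
have em : fset_min S = v by apply/eqP; rewrite eqn_leq vm mle ?WS.
(* Reflecting the maximum gives an element not below the minimum and conversely; the two
   inequalities force the sum to be [tau]. *)
have [lw /WS/mle h1] := symW w wW; have [lv /WS/Mge h2] := symW v vW.
by move: h1 h2; rewrite em eM; clear -lw lv; lia.
Qed.
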